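(* Let $n\ge 4$ be an integer and assume that $\mathcal H_{F,r^2}(n)$ is semisimple (equivalently $r^{2k}\neq 1$ for all integers $1\le k\le n$). Then there exists an irreducible $\frac{n(n-3)}{2}$-dimensional invariant subspace of $\mathcal V^{(n)}$ if and only if $l=r$. If so, it is unique.
   Context: Let $l,r$ be nonzero complex numbers with $r^2\ne1$, $m=\frac1r-r$ and $F=\mathbb{Q}(l,r)\subseteq\mathbb{C}$. The Lawrence--Krammer space $\mathcal V^{(n)}$ is the $F$-vector space with basis $(w_{s,t})_{1\le s<t\le n}$ (also written $w_{st}$). For $1\le i\le n-1$ the generator $g_i$ acts by the endomorphism $\nu_i$ defined by: - $\nu_i(w_{i,i+1})=\frac1l w_{i,i+1}$; - $\nu_i(w_{s,i})=w_{s,i+1}$ for $s\le i-1$; - $\nu_i(w_{i+1,k})=w_{i,k}+m\,r^{k-i-2}\,w_{i,i+1}-m\,w_{i+1,k}$ for $k\ge i+2$; - $\nu_i(w_{s,i+1})=w_{s,i}+\frac{m}{l\,r^{i-s-1}}\,w_{i,i+1}-m\,w_{s,i+1}$ for $s\le i-1$; - $\nu_i(w_{i,k})=w_{i+1,k}$ for $k\ge i+2$; - $\nu_i(w_{s,k})=r\,w_{s,k}$ in all remaining cases ($\{s,k\}\cap\{i,i+1\}=\emptyset$). This defines the (Birman--Murakami--Wenzl algebra version of the) Lawrence--Krammer representation $\nu^{(n)}$. An invariant subspace is a subspace stable under all $\nu_i$; it is irreducible if it is nonzero and has no invariant subspaces other than $0$ and itself. $\mathcal H_{F,r^2}(n)$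 is the Iwahori--Hecke algebra of $Sym(n)$ with parameter $r^2$ over $F$, generated (after rescaling) by $g_1,\dots,g_{n-1}$ with the braid relations and $g_i^2+m\,g_i=1$. *)

(* Defs.v *)
From HB Require Import structures.
From mathcomp Require Import all_boot all_order all_algebra.
From mathcomp Require Import boolp classical_sets reals.
From mathcomp Require Import complex.
Import Order.TTheory GRing.Theory Num.Theory.

Set Implicit Arguments.
Unset Strict Implicit.
Unset Printing Implicit Defensive.

Local Open Scope ring_scope.
Local Open Scope quotient_scope.

Section Adjoin.
Variables (L : fieldType) (l r : L).

Definition adjoin_pred : {pred L} := fun x =>
  `[< forall S : {pred L}, divring_closed S -> l \in S -> r \in S -> x \in S >].

Fact adjoin_divring_closed : divring_closed adjoin_pred.
Proof.
split=> [|x y /asboolP hx /asboolP hy|x y /asboolP hx /asboolP hy];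
  apply/asboolP => S SS lS rS; case: (SS) => S1 SB SV //.
- by apply: SB; [apply: hx | apply: hy].
- by apply: SV; [apply: hx | apply: hy].
Qed.

HB.instance Definition _ :=
  GRing.isDivringClosed.Build L adjoin_pred adjoin_divring_closed.

(* When L has characteristic 0 its prime field is Q, so this is Q(l, r). *)
Record adjoin2 : Type :=
  Adjoin2 { adjoin2_val :> L; _ : adjoin2_val \in adjoin_pred }.

HB.instance Definition _ := [isSub for adjoin2_val].
HB.instance Definition _ := [Choice of adjoin2 by <:].
HB.instance Definition _ := [SubChoice_isSubIntegralDomain of adjoin2 by <:].
HB.instance Definition _ := [SubIntegralDomain_isSubField of adjoin2 by <:].

Fact adjoin_l_subproof : l \in adjoin_pred.
Proof. exact/asboolP. Qed.
Fact adjoin_r_subproof : r \in adjoin_pred.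
Proof. exact/asboolP. Qed.

Definition adjoin_l : adjoin2 := Adjoin2 adjoin_l_subproof.
Definition adjoin_r : adjoin2 := Adjoin2 adjoin_r_subproof.

End Adjoin.

Inductive aexpr (K X : Type) : Type :=
| AGen of X
| ACst of K
| AAdd of aexpr K X & aexpr K X
| AMul of aexpr K X & aexpr K X.

Arguments AGen {K X}.
Arguments ACst {K X}.

HB.instance Definition _ (K X : Type) := gen_eqMixin (aexpr K X).
HB.instance Definition _ (K X : Type) := gen_choiceMixin (aexpr K X).

Section Presented.
Variables (K : fieldType) (X : Type).
Variable rel : aexpr K X -> aexpr K X -> Prop.

(* The least congruence on formal expressions that contains rel and makes the
   quotient an associative unital K-algebra, in which ACst is the structure
   morphism from K. *)
Inductive acong : aexpr K X -> aexpr K X -> Prop :=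
| acong_rel a b : rel a b -> acong a b
| acong_refl a : acong a a
| acong_sym a b : acong a b -> acong b a
| acong_trans b a c : acong a b -> acong b c -> acong a c
| acong_add a a' b b' :
    acong a a' -> acong b b' -> acong (AAdd a b) (AAdd a' b')
| acong_mul a a' b b' :
    acong a a' -> acong b b' -> acong (AMul a b) (AMul a' b')
| acong_addA a b c : acong (AAdd a (AAdd b c)) (AAdd (AAdd a b) c)
| acong_addC a b : acong (AAdd a b) (AAdd b a)
| acong_add0 a : acong (AAdd (ACst 0) a) a
| acong_addN a : acong (AAdd (AMul (ACst (-1)) a) a) (ACst 0)
| acong_mulA a b c : acong (AMul a (AMul b c)) (AMul (AMul a b) c)
| acong_mul1l a : acong (AMul (ACst 1) a) a
| acong_mul1r a : acong (AMul a (ACst 1)) a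
| acong_mulDl a b c : acong (AMul (AAdd a b) c) (AAdd (AMul a c) (AMul b c))
| acong_mulDr a b c : acong (AMul a (AAdd b c)) (AAdd (AMul a b) (AMul a c))
| acong_cstD x y : acong (ACst (x + y)) (AAdd (ACst x) (ACst y))
| acong_cstM x y : acong (ACst (x * y)) (AMul (ACst x) (ACst y))
| acong_cstC x a : acong (AMul (ACst x) a) (AMul a (ACst x)).

Definition acongb (a b : aexpr K X) : bool := `[< acong a b >].

Fact acongb_equiv : equiv_class_of acongb.
Proof.
split=> [a|a b|b a c].
- exact/asboolP/acong_refl.
- by apply/asboolP/asboolP; apply: acong_sym.
- by move=> /asboolP ab /asboolP bc; apply/asboolP; apply: acong_trans ab bc.
Qed.

Canonical acongb_equiv_rel := EquivRelPack acongb_equiv.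

Definition palg : Type := {eq_quot acongb}.
HB.instance Definition _ := Choice.on palg.
HB.instance Definition _ := EqQuotient.on palg.

Fact palg_piP a b : (\pi_palg a = \pi_palg b) <-> acong a b.
Proof. by split=> [/eqmodP/asboolP|h] //; apply/eqmodP/asboolP. Qed.

Definition palg_cst (x : K) : palg := \pi_palg (ACst x).
Definition palg_gen (x : X) : palg := \pi_palg (AGen x).
Definition palg_add (u v : palg) : palg := \pi_palg (AAdd (repr u) (repr v)).
Definition palg_mul (u v : palg) : palg := \pi_palg (AMul (repr u) (repr v)).
Definition palg_opp (u : palg) : palg := palg_mul (palg_cst (-1)) u.
Definition palg_scale (x : K) (u : palg) : palg := palg_mul (palg_cst x) u.

Fact palg_repr_pi a : acong (repr (\pi_palg a)) a.
Proof. by apply/palg_piP; rewrite reprK. Qed.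

Fact palg_addE a b : palg_add (\pi a) (\pi b) = \pi_palg (AAdd a b).
Proof. by apply/palg_piP; apply: acong_add; apply: palg_repr_pi. Qed.

Fact palg_mulE a b : palg_mul (\pi a) (\pi b) = \pi_palg (AMul a b).
Proof. by apply/palg_piP; apply: acong_mul; apply: palg_repr_pi. Qed.

Fact palg_addA : associative palg_add.
Proof.
move=> u v w; rewrite -[u]reprK -[v]reprK -[w]reprK !palg_addE.
exact/palg_piP/acong_addA.
Qed.

Fact palg_addC : commutative palg_add.
Proof.
move=> u v; rewrite -[u]reprK -[v]reprK !palg_addE.
exact/palg_piP/acong_addC.
Qed.

Fact palg_add0 : left_id (palg_cst 0) palg_add.
Proof.
by move=> u; rewrite -[u]reprK palg_addE; apply/palg_piP/acong_add0.
Qed.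

Fact palg_addN : left_inverse (palg_cst 0) palg_opp palg_add.
Proof.
move=> u; rewrite /palg_opp -[u]reprK palg_mulE palg_addE.
exact/palg_piP/acong_addN.
Qed.

Fact palg_mulA : associative palg_mul.
Proof.
move=> u v w; rewrite -[u]reprK -[v]reprK -[w]reprK !palg_mulE.
exact/palg_piP/acong_mulA.
Qed.

Fact palg_mul1l : left_id (palg_cst 1) palg_mul.
Proof.
by move=> u; rewrite -[u]reprK palg_mulE; apply/palg_piP/acong_mul1l.
Qed.

Fact palg_mul1r : right_id (palg_cst 1) palg_mul.
Proof.
by move=> u; rewrite -[u]reprK palg_mulE; apply/palg_piP/acong_mul1r.
Qed.

Fact palg_mulDl : left_distributive palg_mul palg_add.
Proof.
move=> u v w; rewrite -[u]reprK -[v]reprK -[w]reprK.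
rewrite palg_addE !palg_mulE palg_addE.
exact/palg_piP/acong_mulDl.
Qed.

Fact palg_mulDr : right_distributive palg_mul palg_add.
Proof.
move=> u v w; rewrite -[u]reprK -[v]reprK -[w]reprK.
rewrite palg_addE !palg_mulE palg_addE.
exact/palg_piP/acong_mulDr.
Qed.

HB.instance Definition _ := GRing.isZmodule.Build palg
  palg_addA palg_addC palg_add0 palg_addN.
HB.instance Definition _ := GRing.Zmodule_isPzRing.Build palg
  palg_mulA palg_mul1l palg_mul1r palg_mulDl palg_mulDr.

Fact palg_cstD x y : palg_cst (x + y) = palg_add (palg_cst x) (palg_cst y).
Proof. by rewrite palg_addE; apply/palg_piP/acong_cstD. Qed.

Fact palg_cstM x y : palg_cst (x * y) = palg_mul (palg_cst x) (palg_cst y).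
Proof. by rewrite palg_mulE; apply/palg_piP/acong_cstM. Qed.

Fact palg_cstC x u : palg_mul (palg_cst x) u = palg_mul u (palg_cst x).
Proof. by rewrite -[u]reprK !palg_mulE; apply/palg_piP/acong_cstC. Qed.

Fact palg_scaleA x y u :
  palg_scale x (palg_scale y u) = palg_scale (x * y) u.
Proof. by rewrite /palg_scale palg_cstM palg_mulA. Qed.

Fact palg_scale1 : left_id 1 palg_scale.
Proof. exact: palg_mul1l. Qed.

Fact palg_scaleDr : right_distributive palg_scale +%R.
Proof. by move=> x u v; apply: palg_mulDr. Qed.

Fact palg_scaleDl u : {morph palg_scale^~ u : x y / x + y}.
Proof. by move=> x y; rewrite /palg_scale palg_cstD; apply: palg_mulDl. Qed.

HB.instance Definition _ := GRing.Zmodule_isLmodule.Build K palg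
  palg_scaleA palg_scale1 palg_scaleDr palg_scaleDl.

(* The library's algebras are nontrivial rings, whereas a presented algebra can
   be trivial; so the algebra axioms remain plain lemmas. *)
Fact palg_scaleAl x (u v : palg) : x *: (u * v) = x *: u * v.
Proof. exact: palg_mulA. Qed.

Fact palg_scaleAr x (u v : palg) : x *: (u * v) = u * (x *: v).
Proof.
rewrite palg_scaleAl; rewrite -[u * _]/(palg_mul u (palg_mul (palg_cst x) v)).
by rewrite palg_mulA -palg_cstC.
Qed.

End Presented.

Definition left_ideal (A : pzRingType) (I : set A) : Prop :=
  [/\ I 0, forall x y, I x -> I y -> I (x + y) & forall a x, I x -> I (a * x)].

(* That is, the left regular module is completely reducible. *)
Definition semisimple_ring (A : pzRingType) : Prop :=
  forall I : set A, left_ideal I ->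
  exists J : set A, [/\ left_ideal J,
    forall x, I x -> J x -> x = 0 &
    forall x, exists y z, [/\ I y, J z & x = y + z]].

Section Hecke.
Variables (K : fieldType) (r : K) (n : nat).

(* The generators g_i are indexed from 0, that is by i < n - 1. If T_i are the
   usual generators, with (T_i - r ^+ 2) (T_i + 1) = 0, then g_i = T_i / r. *)
Inductive hecke_rel : aexpr K 'I_n.-1 -> aexpr K 'I_n.-1 -> Prop :=
| hecke_quadratic i :
    hecke_rel (AAdd (AMul (AGen i) (AGen i)) (AMul (ACst (r^-1 - r)) (AGen i)))
              (ACst 1)
| hecke_braid (i j : 'I_n.-1) : j = i.+1 :> nat ->
    hecke_rel (AMul (AGen i) (AMul (AGen j) (AGen i)))
              (AMul (AGen j) (AMul (AGen i) (AGen j)))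
| hecke_commute (i j : 'I_n.-1) : (i.+1 < j)%N ->
    hecke_rel (AMul (AGen i) (AGen j)) (AMul (AGen j) (AGen i)).

Definition hecke : Type := palg hecke_rel.
HB.instance Definition _ := GRing.PzRing.on hecke.
HB.instance Definition _ := GRing.Lmodule.on hecke.

End Hecke.

Section LawrenceKrammer.
Variables (K : fieldType) (l r : K) (n : nat).

Definition lk_index : Type := {p : 'I_n * 'I_n | p.1 < p.2}%N.
HB.instance Definition _ := Finite.on lk_index.

Definition lk_space : Type := {ffun lk_index -> K^o}.
HB.instance Definition _ := Vector.on lk_space.

(* For s < t < n this is the basis vector usually written w_{s+1,t+1}: indices
   start at 0, which does not affect the action below, since only differences
   of indices occur in its coefficients. Otherwise w s t is zero. *)
Definition lk_w (s t : nat) : lk_space :=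
  [ffun p : lk_index => (((val p).1 == s :> nat) && ((val p).2 == t :> nat))%:R].

Local Notation m := (r^-1 - r).
Local Notation w := lk_w.

Definition lk_nu_w (i s t : nat) : lk_space :=
  if (s == i) && (t == i.+1) then l^-1 *: w i i.+1
  else if t == i then w s i.+1
  else if s == i.+1 then
    w i t + (m * r ^+ (t - i - 2)) *: w i i.+1 - m *: w i.+1 t
  else if t == i.+1 then
    w s i + (m / (l * r ^+ (i - s - 1))) *: w i i.+1 - m *: w s i.+1
  else if s == i then w i.+1 t
  else r *: w s t.

Definition lk_nu_fun (i : nat) (v : lk_space) : lk_space :=
  \sum_(p : lk_index) (v p : K) *: lk_nu_w i (val p).1 (val p).2.

Fact lk_nu_is_linear i : linear (lk_nu_fun i).
Proof.
move=> a u v; rewrite /lk_nu_fun scaler_sumr -big_split /=.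
by apply: eq_bigr => p _; rewrite !ffunE scalerDl scalerA.
Qed.

HB.instance Definition _ i :=
  GRing.isLinear.Build K lk_space lk_space _ (lk_nu_fun i) (lk_nu_is_linear i).

Definition lk_nu (i : 'I_n.-1) : 'End(lk_space) := linfun (lk_nu_fun i).

Definition lk_invariant (W : {vspace lk_space}) : Prop :=
  forall i : 'I_n.-1, (lk_nu i @: W <= W)%VS.

(* For W itself invariant: the definition does not require it. *)
Definition lk_irreducible (W : {vspace lk_space}) : Prop :=
  W <> 0%VS /\
  forall U : {vspace lk_space},
    lk_invariant U -> (U <= W)%VS -> U = 0%VS \/ U = W.

End LawrenceKrammer.

(* Main.v *)
From HB Require Import structures.
Require Import Defs.
From mathcomp Require Import all_boot all_order all_algebra.
From mathcomp Require Import boolp classical_sets functions reals complex.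
From mathcomp Require Import zify ring.
Import Order.TTheory GRing.Theory Num.Theory.
Local Open Scope ring_scope.

Set Implicit Arguments.
Unset Strict Implicit.
Unset Printing Implicit Defensive.

(* Let Y = w_{24} - r w_{14} - r w_{23} + r^2 w_{13} (in 1-based indices).  On all of
   V the product (g_3 - r)(g_1 - r) has image the line K Y.  The image of
   g_i^2 + m g_i - 1 lies in K w_{i,i+1}, and w_{i,i+1} generates V, so the Hecke
   relation g_i^2 + m g_i = 1 holds on every proper invariant subspace.
   If W is as in the theorem and does not contain Y, then (g_j - r)(g_1 - r) = 0 on W
   for all j >= 3, which forces each g_i - r to have rank at most 1 on W; as W has no
   common eigenvector, dim W <= n - 1, so n = 4 and dim W = 2, and the braid relations
   give (r + 1/r)^2 = 2, contradicting semisimplicity.  So Y lies in W, and the Hecke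
   relation for g_2 at Y gives l = r or l = - r^3.  The invariant subspace generated by
   Y has codimension at most n, and at most n - 1 if l = - r^3, which rules out the
   latter.  Uniqueness follows, because two solutions would both contain Y.
   If l = r, the common kernel D of the n functionals S_j below is invariant, contains
   Y and has dimension n (n - 3) / 2, so Y generates it.  It is irreducible: if U is an
   invariant subspace of D without Y, split Y = x + y with y in U and with the module
   generated by x meeting U trivially; applying (g_3 - r)(g_1 - r) shows that x
   generates Y, hence D, so U = 0.
   Semisimplicity enters through such splittings, applied also to modules of functions
   on words, where they show that 1 + r^2 and the sum of r^{2k} for k < n are nonzero. *)

(** * Cyclic submodules and complements for a presented algebra *)

Section SplitCyclic.
Variables (K : fieldType) (X : Type) (V : lmodType K).
Variable g : X -> {linear V -> V}.

(** Formal expressions act, rather than the presented algebra itself, because the relations may fail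
    on [V]: they are required only on the stable part [D]. *)
Fixpoint aeval (a : aexpr K X) (v : V) : V :=
  match a with
  | AGen x => g x v
  | ACst k => k *: v
  | AAdd a b => aeval a v + aeval b v
  | AMul a b => aeval a (aeval b v)
  end.

Lemma aeval_linear a : linear (aeval a).
Proof.
elim: a => [x|c|a iha b ihb|a iha b ihb] k u v /=.
- exact: linearP.
- by rewrite scalerDr !scalerA mulrC.
- by rewrite iha ihb scalerDr addrACA.
- by rewrite ihb iha.
Qed.

HB.instance Definition _ a :=
  GRing.isLinear.Build K V V _ (aeval a) (aeval_linear a).

(** Submodules are predicates because the functions on words used below form an infinite-dimensional
    space. *)
Definition gstable (N : V -> Prop) : Prop :=
  [/\ N 0, forall u v, N u -> N v -> N (u + v), forall k v, N v -> N (k *: v) &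
      forall x v, N v -> N (g x v)].

Lemma gstable_aeval (N : V -> Prop) : gstable N ->
  forall a v, N v -> N (aeval a v).
Proof.
move=> [N0 ND NZ Ng]; elim=> [x|c|a iha b ihb|a iha b ihb] v Nv /=.
- exact: Ng.
- exact: NZ.
- by apply: ND; auto.
- by auto.
Qed.

Lemma gstableB (N : V -> Prop) : gstable N ->
  forall u v, N u -> N v -> N (u - v).
Proof.
by move=> [_ ND NZ _] u v Nu Nv; rewrite -scaleN1r; apply: ND => //; apply: NZ.
Qed.

Variables (rel : aexpr K X -> aexpr K X -> Prop) (D : V -> Prop).
Hypothesis Dg : gstable D.
Hypothesis Drel : forall a b, rel a b -> forall v, D v -> aeval a v = aeval b v.

Lemma aeval_acong a b : acong rel a b -> forall v, D v -> aeval a v = aeval b v.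
Proof.
elim=> {a b} /=.
- exact: Drel.
- by [].
- by move=> a b _ ih v Dv; rewrite ih.
- by move=> b a c _ ih1 _ ih2 v Dv; rewrite ih1 // ih2.
- by move=> a a' b b' _ ih1 _ ih2 v Dv; rewrite ih1 // ih2.
- by move=> a a' b b' _ ih1 _ ih2 v Dv; rewrite ih2 // ih1 //; apply: gstable_aeval.
- by move=> a b c v _; rewrite addrA.
- by move=> a b v _; rewrite addrC.
- by move=> a v _; rewrite scale0r add0r.
- by move=> a v _; rewrite scaleN1r addNr scale0r.
- by [].
- by move=> a v _; rewrite scale1r.
- by move=> a v _; rewrite scale1r.
- by [].
- by move=> a b c v _; rewrite linearD.
- by move=> x y v _; rewrite scalerDl.
- by move=> x y v _; rewrite scalerA.
- by move=> x a v _; rewrite linearZ.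
Qed.

Let repr_aeval a v : D v -> aeval (repr (\pi_(palg rel)%qT a)) v = aeval a v.
Proof. by move=> Dv; apply: aeval_acong => //; apply: palg_repr_pi. Qed.

(* If 1 = y + z along a decomposition of the algebra into the left ideal
   {a | a u \in N} and a complement of it, then x := z u works. *)
Lemma split_cyclic (N : V -> Prop) (u : V) :
    semisimple_ring (palg rel) -> gstable N -> D u ->
  exists x, [/\ D x, N (u - x) & forall a, N (aeval a x) -> aeval a x = 0].
Proof.
move=> ss gN Du; have [N0 ND NZ Ng] := gN.
pose I : set (palg rel) := fun q => N (aeval (repr q) u).
have idI : left_ideal I.
  split.
  - by rewrite /I -[0]/(palg_cst rel 0) repr_aeval //= scale0r.
  - move=> x y; rewrite /I -[x + y]/(palg_add x y) repr_aeval //=.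
    exact: ND.
  - move=> a x; rewrite /I -[a * x]/(palg_mul a x) repr_aeval //=.
    exact: gstable_aeval.
have [J [[_ _ JM] IJ0 IJ]] := ss I idI.
have [y [z [Iy Jz yz]]] := IJ 1.
have uE : u = aeval (repr y) u + aeval (repr z) u.
  have : aeval (repr (1 : palg rel)) u = aeval (repr (palg_add y z)) u.
    by rewrite yz.
  by rewrite -[1]/(palg_cst rel 1) !repr_aeval //= scale1r.
exists (aeval (repr z) u); split.
- exact: gstable_aeval.
- by rewrite {1}uE addrK.
(* The class of [a] times [z] lies in the left ideal [J], and in [I] by [Na]. *)
- move=> a Na; have az0 : (\pi_(palg rel)%qT a) * z = 0.
    apply: IJ0; last exact: JM.
    rewrite /I -[_ * z]/(palg_mul (\pi_(palg rel)%qT a) z) repr_aeval //=.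
    by rewrite repr_aeval //; apply: gstable_aeval.
  have := congr1 (fun q : palg rel => aeval (repr q) u) az0.
  rewrite -[_ * z]/(palg_mul (\pi_(palg rel)%qT a) z) repr_aeval //=.
  rewrite repr_aeval; last exact: gstable_aeval.
  by rewrite -[0 in RHS]/(palg_cst rel 0) repr_aeval //= scale0r.
Qed.

End SplitCyclic.

(** * The Hecke algebra acting on functions on words *)

Section Words.
Variables (K : fieldType) (r : K).
Hypothesis r0 : r != 0.
Local Notation m := (r^-1 - r).

(** Words are infinite, so that [wswap i] needs no bound on [i]. *)
Definition word := nat -> nat.
Definition wfun := word -> K^o.
HB.instance Definition _ := GRing.Lmodule.on wfun.

Definition wswap (i : nat) (x : word) : word :=
  fun k => if k == i then x i.+1 else if k == i.+1 then x i else x k.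

(* The Hecke algebra action of Jimbo's R-matrix, on functions on words. *)
Definition wact (i : nat) (f : wfun) : wfun := fun x =>
  if x i == x i.+1 then r * f x
  else if (x i < x i.+1)%N then f (wswap i x)
  else f (wswap i x) - m * f x.

Let scaleoE (a : K) (b : K^o) : a *: b = a * b. Proof. by []. Qed.

Lemma wact_linear i : linear (wact i).
Proof.
move=> k f g; apply/funext => x; rewrite /wact !fctE !scaleoE.
by case: ifP => _; last case: ifP => _; ring.
Qed.

HB.instance Definition _ i :=
  GRing.isLinear.Build K wfun wfun _ (wact i) (wact_linear i).

Lemma wswapK i : involutive (wswap i).
Proof.
move=> x; apply/funext => k; rewrite /wswap !eqxx.
by have [->|] := eqVneq k i; [rewrite gtn_eqF | have [->|] := eqVneq k i.+1].
Qed.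

Lemma wswapl i x : wswap i x i = x i.+1.
Proof. by rewrite /wswap eqxx. Qed.

Lemma wswapr i x : wswap i x i.+1 = x i.
Proof. by rewrite /wswap gtn_eqF // eqxx. Qed.

Lemma wswap_id i x k : k != i -> k != i.+1 -> wswap i x k = x k.
Proof. by rewrite /wswap => /negPf-> /negPf->. Qed.

Lemma wact_quadratic i f : wact i (wact i f) + m *: wact i f = f.
Proof.
apply/funext => x; rewrite !fctE !scaleoE /wact wswapl wswapr wswapK.
rewrite [x i.+1 == x i]eq_sym.
case: (ltngtP (x i) (x i.+1)) => _ /=; first by ring.
  by ring.
by field.
Qed.

Lemma wswap_braid i x :
  wswap i (wswap i.+1 (wswap i x)) = wswap i.+1 (wswap i (wswap i.+1 x)).
Proof.
apply/funext => k; rewrite /wswap; repeat case: eqP => //; lia.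
Qed.

(** Only the relative order of the letters at [i], [i.+1], [i.+2] matters; each order gives an
    identity in [r] and the values of [f] at rearrangements of [x]. *)
Lemma wact_braid i f :
  wact i (wact i.+1 (wact i f)) = wact i.+1 (wact i (wact i.+1 f)).
Proof.
have wl k x : wswap k x k.+2 = x k.+2 by apply: wswap_id; lia.
have wr k x : wswap k.+1 x k = x k by apply: wswap_id; lia.
apply/funext => x; rewrite /wact !(wswapl, wswapr, wl, wr, wswapK) wswap_braid.
case: (ltngtP (x i) (x i.+1)); case: (ltngtP (x i.+1) (x i.+2));
  case: (ltngtP (x i) (x i.+2)) => /=; try lia; intros; try by [|ring]; try by field.
Qed.

Lemma wact_commute i j f : (i.+1 < j)%N ->
  wact i (wact j f) = wact j (wact i f).
Proof.
move=> ij; have wE x : [/\ wswap i x j = x j, wswap i x j.+1 = x j.+1,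
    wswap j x i = x i & wswap j x i.+1 = x i.+1].
  by split; apply: wswap_id; lia.
have wC x : wswap i (wswap j x) = wswap j (wswap i x).
  apply/funext => k; rewrite /wswap; repeat case: eqP => //; lia.
apply/funext => x; rewrite /wact; have [-> -> -> ->] := wE x.
rewrite wC; repeat case: ifP => _; ring.
Qed.

End Words.

Lemma aeval_hecke_rel (K : fieldType) (r : K) (n : nat) (V : lmodType K)
    (g : nat -> {linear V -> V}) (D : V -> Prop) :
    gstable (fun i : 'I_n.-1 => g i) D ->
    (forall i v, (i.+1 < n)%N -> D v -> g i (g i v) + (r^-1 - r) *: g i v = v) ->
    (forall i v, (i.+2 < n)%N -> D v ->
       g i (g i.+1 (g i v)) = g i.+1 (g i (g i.+1 v))) ->
    (forall i j v, (i.+1 < j)%N -> (j.+1 < n)%N -> D v ->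
       g i (g j v) = g j (g i v)) ->
  forall a b, hecke_rel r a b -> forall v, D v ->
    aeval (fun i : 'I_n.-1 => g i) a v = aeval (fun i : 'I_n.-1 => g i) b v.
Proof.
move=> [_ _ _ gD] quad braid comm a b.
case=> {a b} [i|i j ji|i j ij] v Dv /=.
- by rewrite scale1r quad //; have := ltn_ord i; lia.
- by rewrite ji braid //; have := ltn_ord j; lia.
- by rewrite comm //; have := ltn_ord j; lia.
Qed.

(** * Restrictions on [r] imposed by semisimplicity *)

Section HeckeParameter.
Variables (K : fieldType) (r : K) (n : nat).
Hypothesis r0 : r != 0.
Hypothesis ss : semisimple_ring (hecke r n).
Local Notation m := (r^-1 - r).
Local Notation g := (fun i : 'I_n.-1 => wact r i).

(** This is [split_cyclic] for the algebra elements [g_i - r], with [D] the whole space. It lifts an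
    eigenvector for [r] in the quotient by [N] to an actual eigenvector. *)
Lemma split_wfun (N : wfun K -> Prop) (u : wfun K) :
    gstable (g : 'I_n.-1 -> {linear wfun K -> wfun K}) N ->
  exists2 x, N (u - x) &
    forall i, (i < n.-1)%N -> N (wact r i x - r *: x) -> wact r i x = r *: x.
Proof.
move=> gN.
have gT : gstable (g : 'I_n.-1 -> {linear wfun K -> wfun K}) (fun=> True) by [].
have relP := @aeval_hecke_rel K r n _ (wact r) (fun=> True) gT
  (fun i v _ _ => wact_quadratic r0 i v) (fun i v _ _ => wact_braid r0 i v)
  (fun i j v ij _ _ => wact_commute r0 v ij).
have [x [_ Nx xP]] := split_cyclic gT relP (u := u) ss gN I.
exists x => // i ni Ni.
have := xP (AAdd (AGen (Ordinal ni)) (ACst (- r))).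
by rewrite /= scaleNr => /(_ Ni)/eqP; rewrite subr_eq0 => /eqP.
Qed.

Let scaleoE (a : K) (b : K^o) : a *: b = a * b. Proof. by []. Qed.

(** The boolean read as a letter is 0 at [s] and 1 elsewhere. Evaluation at these words, for
    [s < n], gives a deformation of the permutation module on [n] points. *)
Definition word1 (s : nat) : word := fun k => (k != s).

Lemma wact_word1l i (f : wfun K) : wact r i f (word1 i) = f (word1 i.+1).
Proof.
have -> : word1 i.+1 = wswap i (word1 i).
  by apply/funext => k; rewrite /wswap /word1; repeat case: eqP => //=; lia.
by rewrite /wact /word1 eqxx (gtn_eqF (ltnSn i)).
Qed.

Lemma wact_word1r i (f : wfun K) :
  wact r i f (word1 i.+1) = f (word1 i) - m * f (word1 i.+1).
Proof.
have -> : word1 i = wswap i (word1 i.+1).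
  by apply/funext => k; rewrite /wswap /word1; repeat case: eqP => //=; lia.
by rewrite /wact /word1 eqxx (ltn_eqF (ltnSn i)).
Qed.

Lemma wact_word1 i s (f : wfun K) : s != i -> s != i.+1 ->
  wact r i f (word1 s) = r * f (word1 s).
Proof. by move=> si si1; rewrite /wact /word1 ![_ == s]eq_sym si si1. Qed.

(** The class of [u] modulo the kernel of [lam] lifts to a common eigenvector [x], whose value at
    [word1 s] is [r ^+ s] times that at [word1 0]. Hence [lam x] is a multiple of the sum in
    question, whereas [lam x = lam u = 1]. *)
Lemma semisimple_hecke_quantum_int : (0 < n)%N ->
  \sum_(s < n) r ^+ (2 * s) != 0.
Proof.
move=> n0; apply/eqP => rn0.
(* Modulo the kernel of the functional lam, every g_i acts as the scalar r. *)
pose lam (f : wfun K) : K := \sum_(s < n) r ^+ s * f (word1 s).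
have lamD a f h : lam (a *: f + h) = a * lam f + lam h.
  rewrite /lam mulr_sumr -big_split /=; apply: eq_bigr => s _.
  by rewrite !fctE scaleoE; ring.
have lamg i f : (i < n.-1)%N -> lam (wact r i f) = r * lam f.
  move=> ni; have ni0 : (i < n)%N by lia.
  have ni1 : (i.+1 < n)%N by lia.
  have ne : (Ordinal ni1 != Ordinal ni0) by rewrite -val_eqE /=; lia.
  rewrite /lam (bigD1 (Ordinal ni0)) //= (bigD1 (Ordinal ni1)) //=.
  rewrite [in RHS](bigD1 (Ordinal ni0)) //= [in RHS](bigD1 (Ordinal ni1)) //=.
  rewrite wact_word1l wact_word1r !mulrDr addrA [in RHS]addrA.
  congr (_ + _); first by rewrite exprS; field.
  rewrite mulr_sumr; apply: eq_bigr => s /andP[s1 s2].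
  by rewrite wact_word1 // mulrCA.
have gN : gstable (g : 'I_n.-1 -> {linear wfun K -> wfun K}) (fun f => lam f = 0).
  split.
  - by rewrite /lam big1 // => s _; rewrite mulr0.
  - by move=> u v lu lv; rewrite -[u]scale1r lamD lu lv mulr0 addr0.
  - move=> k v lv; rewrite -[k *: v]addr0 lamD lv mulr0 add0r.
    by rewrite /lam big1 // => s _; rewrite mulr0.
  - by move=> i v lv; rewrite lamg // lv mulr0.
(* Among the words [word1 s] only [word1 0] starts with 0, so [lam u = 1]. *)
pose u : wfun K := fun x => (x 0 == 0)%:R.
have [x lux gx] := split_wfun u gN.
have lu : lam u = 1.
  rewrite /lam (bigD1 (Ordinal n0)) //= big1 => [|s s0]; rewrite /u /word1.
    by rewrite eqxx mulr1 expr0 addr0.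
  by rewrite (_ : (0 != s)%N) /= ?mulr0 // eq_sym.
have gx' i : (i < n.-1)%N -> wact r i x = r *: x.
  move=> ni; apply: (gx _ ni).
  rewrite -scaleNr addrC lamD lamg //; ring.
have xs s : (s < n)%N -> x (word1 s) = r ^+ s * x (word1 0).
  elim: s => [|s ih sn]; first by rewrite expr0 mul1r.
  have ni : (s < n.-1)%N by lia.
  have := congr1 (@^~ (word1 s)) (gx' _ ni) => /=.
  rewrite wact_word1l fctE scaleoE => ->.
  by rewrite ih ?(ltnW sn) // exprS mulrA.
have : lam x = 0.
  transitivity ((\sum_(s < n) r ^+ (2 * s)) * x (word1 0)); last by rewrite rn0 mul0r.
  rewrite mulr_suml.
  by apply: eq_bigr => s _; rewrite xs // mulrA mul2n -addnn exprD.
move=> lx; have : lam u = 0.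
  have -> : u = 1 *: (u - x) + x by rewrite scale1r subrK.
  by rewrite lamD lux lx mulr0 addr0.
by rewrite lu => /eqP; rewrite oner_eq0.
Qed.

Definition word2 (s t : nat) : word :=
  fun k => if k == s then 0 else if k == t then 1 else 2.

Lemma wact_word2l i (f : wfun K) : wact r i f (word2 i i.+1) = f (word2 i.+1 i).
Proof.
have -> : word2 i.+1 i = wswap i (word2 i i.+1).
  by apply/funext => k; rewrite /wswap /word2; repeat case: eqP => //=; lia.
by rewrite /wact /word2 !eqxx (gtn_eqF (ltnSn i)).
Qed.

Lemma wact_word2r i (f : wfun K) :
  wact r i f (word2 i.+1 i) = f (word2 i i.+1) - m * f (word2 i.+1 i).
Proof.
have -> : word2 i i.+1 = wswap i (word2 i.+1 i).
  by apply/funext => k; rewrite /wswap /word2; repeat case: eqP => //=; lia.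
by rewrite /wact /word2 !eqxx (ltn_eqF (ltnSn i)).
Qed.

(** Identifying the letters 0 and 1 sends [f] to the sums [f (word2 s t) + r * f (word2 t s)], and
    this is equivariant: either [g_i] exchanges the positions [s] and [t], or both words behave
    alike because 0 and 1 compare alike with 2. *)
Lemma wact_word2_sum i s t (f : wfun K) : (s < t)%N ->
    (forall s t, (s < t)%N -> f (word2 s t) + r * f (word2 t s) = 0) ->
  wact r i f (word2 s t) + r * wact r i f (word2 t s) = 0.
Proof.
move=> st fN.
pose sw a := if a == i then i.+1 else if a == i.+1 then i else a.
have swE a b : a != b -> wswap i (word2 a b) = word2 (sw a) (sw b).
  move=> ab; rewrite /sw; apply/funext => k; rewrite /wswap /word2.
  by repeat case: eqP => //=; lia.
have [/andP[/eqP-> /eqP->]|/negP sti] := boolP ((s == i) && (t == i.+1)).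
  rewrite wact_word2l wact_word2r.
  have /eqP := fN i i.+1 (ltnSn i); rewrite addr_eq0 => /eqP ->; field.
  exact: r0.
have wE a b : (a, b) = (s, t) \/ (a, b) = (t, s) ->
    wact r i f (word2 a b) =
    if word2 a b i == word2 a b i.+1 then r * f (word2 a b)
    else if (word2 s t i < word2 s t i.+1)%N
    then f (word2 (sw a) (sw b)) else f (word2 (sw a) (sw b)) - m * f (word2 a b).
  move=> ab; rewrite /wact -swE; last by case: ab => -[-> ->]; lia.
  suff -> : (word2 a b i < word2 a b i.+1)%N = (word2 s t i < word2 s t i.+1)%N by [].
  by case: ab => -[-> ->] //; rewrite /word2; repeat case: eqP => //=; lia.
rewrite !wE; [|by right|by left].
rewrite (_ : (word2 t s i == _) = (word2 s t i == word2 s t i.+1)); last first.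
  by rewrite /word2; repeat case: eqP => //=; lia.
have st' : (sw s < sw t)%N by rewrite /sw; repeat case: eqP => //=; lia.
move: (word2 s t i == _) (word2 s t i < _)%N => [_|[]].
- by rewrite -[RHS](mulr0 r) -(fN _ _ st); ring.
- exact: fN.
- rewrite -[RHS](subr0 0) -{1}(fN _ _ st') -[X in _ = _ - X](mulr0 m) -(fN _ _ st).
  by ring.
Qed.

(** Modulo [N], [u] is an eigenvector of [wact r 0] for [r], so it lifts to an eigenvector [x]. The
    functional defining [N] at the positions 0 and 1 takes the value 1 at [u] and
    [(1 + r ^+ 2) * x (word2 0 1)] at [x], and these agree. *)
Lemma semisimple_hecke_two : (1 < n)%N -> 1 + r ^+ 2 != 0.
Proof.
move=> n1; apply/eqP => r2.
pose N (f : wfun K) := forall s t, (s < t)%N -> f (word2 s t) + r * f (word2 t s) = 0.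
have gN : gstable (g : 'I_n.-1 -> {linear wfun K -> wfun K}) N.
  split.
  - by move=> s t _; apply: etrans (add0r _) (mulr0 _).
  - move=> u v Nu Nv s t st; rewrite !fctE mulrDr addrACA Nu // Nv // addr0 //.
  - by move=> k v Nv s t st; rewrite !fctE !scaleoE mulrCA -mulrDr Nv // mulr0.
  - by move=> i v Nv s t st; apply: wact_word2_sum.
pose u : wfun K := fun x => ((x 0 == 0) && (x 1 == 1))%:R.
have [x Nux gx] := split_wfun u gN.
have n0 : (0 < n.-1)%N by lia.
have Nu : N (wact r 0 u - r *: u).
  move=> s t st; rewrite !fctE !scaleoE /wact /u /wswap /word2 /=.
  by repeat case: eqP => //=; try lia; intros; ring.
have [_ ND NZ Ng] := gN; have NB := gstableB gN.
have gx0 : wact r 0 x = r *: x.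
  apply: gx => //.
  (* This expresses [wact r 0 x - r *: x] through the same difference at [u] and at [u - x], both of
     which lie in [N]. *)
  have dE (a b a0 b0 : wfun K) : a - b = (a0 - b0) - ((a0 - a) - (b0 - b)).
    by rewrite opprB [b0 - b - _]addrC addrACA subKr addKr.
  rewrite (dE _ _ (wact r 0 u) (r *: u)) -scalerBr -linearB.
  by apply: (NB _ _ Nu); apply: NB; [exact: (Ng (Ordinal n0)) | exact: NZ].
have x10 : x (word2 1 0) = r * x (word2 0 1).
  by have := congr1 (@^~ (word2 0 1)) gx0; rewrite /= wact_word2l fctE.
have := Nux 0 1 isT; rewrite !fctE x10 /u /= => /eqP.
have -> : 1 - x (word2 0 1) + r * (0 - r * x (word2 0 1)) =
          1 - (1 + r ^+ 2) * x (word2 0 1) by ring.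
by rewrite r2 mul0r subr0 oner_eq0.
Qed.

End HeckeParameter.

(** * Coordinates on the Lawrence-Krammer space, and the generators on basis vectors *)

Section LKBasis.
Variables (K : fieldType) (l r : K) (n : nat).
Local Notation m := (r^-1 - r).
Local Notation V := (lk_space K n).
Local Notation w := (lk_w K n).
Local Notation G := (lk_nu_fun l r).

Lemma lkD (u v : V) p : (u + v) p = u p + v p :> K. Proof. exact: ffunE. Qed.
Lemma lkN (u : V) p : (- u) p = - u p :> K. Proof. exact: ffunE. Qed.
Lemma lkZ a (u : V) p : (a *: u) p = a * u p :> K. Proof. exact: ffunE. Qed.
Lemma lk0 p : (0 : V) p = 0 :> K. Proof. exact: ffunE. Qed.
Lemma lk_ext (u v : V) : (forall p, u p = v p :> K) -> u = v.
Proof. by move=> uv; apply/ffunP. Qed.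

Definition lkE := (lkD, lkN, lkZ, lk0).

Lemma lk_atD (u v : V) p (a b : K) : u p = a :> K -> v p = b :> K -> (u + v) p = a + b :> K.
Proof. by rewrite lkD => -> ->. Qed.
Lemma lk_atN (u : V) p (a : K) : u p = a :> K -> (- u) p = - a :> K.
Proof. by rewrite lkN => ->. Qed.
Lemma lk_atZ c (u : V) p (a : K) : u p = a :> K -> (c *: u) p = c * a :> K.
Proof. by rewrite lkZ => ->. Qed.
Lemma lk_at_eq (u v : V) p (a b : K) :
  u p = a :> K -> v p = b :> K -> a = b -> u p = v p :> K.
Proof. by move=> -> ->. Qed.

Lemma lk_wE s t (p : lk_index n) :
  w s t p = (((val p).1 == s :> nat) && ((val p).2 == t :> nat))%:R :> K.
Proof. exact: ffunE. Qed.

Lemma lk_index_inj (p q : lk_index n) :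
  (val p).1 = (val q).1 :> nat -> (val p).2 = (val q).2 :> nat -> p = q.
Proof.
move=> e1 e2; apply/val_inj.
by rewrite [val p]surjective_pairing [val q]surjective_pairing (val_inj e1) (val_inj e2).
Qed.

Lemma lk_sum_w (v : V) :
  v = \sum_(p : lk_index n) (v p : K) *: w (val p).1 (val p).2.
Proof.
apply/ffunP => q; rewrite sum_ffunE (bigD1 q) //= lkZ lk_wE !eqxx mulr1.
rewrite big1 ?addr0 // => p pq; rewrite lkZ lk_wE.
case: andP => [[/eqP e1 /eqP e2]|_]; last exact: mulr0.
by case/eqP: pq; apply: lk_index_inj; rewrite ?e1 ?e2.
Qed.

Lemma lk_w_ind (P : V -> Prop) :
    P 0 -> (forall u v, P u -> P v -> P (u + v)) -> (forall a v, P v -> P (a *: v)) ->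
    (forall s t, (s < t)%N -> (t < n)%N -> P (w s t)) ->
  forall v, P v.
Proof.
move=> P0 PD PZ Pw v; rewrite (lk_sum_w v); elim/big_rec: _ => // p u _ Pu.
apply: PD => //; apply: PZ; apply: Pw; last exact: ltn_ord.
exact: (valP p).
Qed.

Lemma lk_nu_fun_w i s t : (s < t)%N -> (t < n)%N ->
  G i (w s t) = lk_nu_w l r n i s t.
Proof.
move=> st tn; have sn := ltn_trans st tn.
pose q : lk_index n := Sub (Ordinal sn, Ordinal tn) st.
rewrite /lk_nu_fun (bigD1 q) //= lk_wE !eqxx scale1r.
rewrite big1 ?addr0 // => p pq; rewrite lk_wE.
case: andP => [[/eqP e1 /eqP e2]|_]; last exact: scale0r.
by case/eqP: pq; apply: lk_index_inj; rewrite ?e1 ?e2.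
Qed.

Lemma nu_diag i : (i.+1 < n)%N -> G i (w i i.+1) = l^-1 *: w i i.+1.
Proof. by move=> ni; rewrite lk_nu_fun_w // /lk_nu_w !eqxx. Qed.

Lemma nu_si i s : (s < i)%N -> (i.+1 < n)%N -> G i (w s i) = w s i.+1.
Proof.
move=> si ni; rewrite lk_nu_fun_w ?(ltnW ni) // /lk_nu_w ltn_eqF //= eqxx.
by [].
Qed.

Lemma nu_ik i k : (i.+1 < k)%N -> (k < n)%N -> G i (w i k) = w i.+1 k.
Proof.
move=> ik kn; rewrite lk_nu_fun_w ?(ltnW ik) // /lk_nu_w eqxx /=.
by rewrite !ifF //; lia.
Qed.

Lemma nu_i1k i k d : (k < n)%N -> k = (i.+2 + d)%N ->
  G i (w i.+1 k) = w i k + (m * r ^+ d) *: w i i.+1 - m *: w i.+1 k.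
Proof.
move=> kn kE; rewrite lk_nu_fun_w //; last lia.
rewrite /lk_nu_w eqxx (_ : k - i - 2 = d)%N; last lia.
by rewrite !(ifF, ifT) //; lia.
Qed.

Lemma nu_si1 i s d : (i.+1 < n)%N -> i = (s.+1 + d)%N ->
  G i (w s i.+1) = w s i + (m / (l * r ^+ d)) *: w i i.+1 - m *: w s i.+1.
Proof.
move=> ni iE; rewrite lk_nu_fun_w //; last lia.
rewrite /lk_nu_w eqxx (_ : i - s - 1 = d)%N; last lia.
by rewrite !ifF //; lia.
Qed.

Lemma nu_other i s t : (s < t)%N -> (t < n)%N ->
    [&& s != i, s != i.+1, t != i & t != i.+1] -> G i (w s t) = r *: w s t.
Proof.
move=> st tn /and4P[s1 s2 t1 t2]; rewrite lk_nu_fun_w // /lk_nu_w.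
by rewrite !ifF //; lia.
Qed.

(** Summing against [w s t] makes the functional total in [s] and [t]; it is zero unless
    [s < t < n]. *)
Definition lk_coord s t (v : V) : K := \sum_(p : lk_index n) w s t p * v p.

Lemma lk_coord_is_linear s t : scalar (lk_coord s t).
Proof.
move=> a u v; rewrite /lk_coord mulr_sumr -big_split /=.
by apply: eq_bigr => p _; rewrite !lkE; ring.
Qed.

HB.instance Definition _ s t :=
  GRing.isLinear.Build K V K _ (lk_coord s t) (lk_coord_is_linear s t).

Lemma lk_coord_val (p : lk_index n) (v : V) : lk_coord (val p).1 (val p).2 v = v p.
Proof.
rewrite /lk_coord (bigD1 p) //= lk_wE !eqxx mul1r big1 ?addr0 // => q qp.
rewrite lk_wE; case: andP => [[/eqP e1 /eqP e2]|_]; last exact: mul0r.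
by case/eqP: qp; apply: lk_index_inj; rewrite ?e1 ?e2.
Qed.

Lemma lk_coord_w s t s' t' : (s < t)%N -> (t < n)%N ->
  lk_coord s t (w s' t') = ((s == s') && (t == t'))%:R.
Proof.
move=> st tn; have sn := ltn_trans st tn.
exact: etrans (lk_coord_val (Sub (Ordinal sn, Ordinal tn) st) _) (lk_wE _ _ _).
Qed.

Lemma lk_coord_eq0 (v : V) :
  (forall s t, (s < t)%N -> (t < n)%N -> lk_coord s t v = 0) -> v = 0.
Proof.
move=> v0; apply/ffunP => p; rewrite lk0 -lk_coord_val; apply: v0 => //.
exact: (valP p).
Qed.

Lemma dim_lk_space : \dim (fullv : {vspace V}) = 'C(n, 2).
Proof.
rewrite dimvf -[LHS]/(#|{: lk_index n}| * 1)%N muln1 card_sig -sum1_card.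
rewrite -(pair_big_dep xpredT (fun i j : 'I_n => (i < j)%N) (fun _ _ => 1%N)) /=.
rewrite (exchange_big_dep xpredT) //= -bin2_sum big_mkord.
apply: eq_bigr => j _; rewrite (big_ord_narrow (ltnW (ltn_ord j))) /=.
by rewrite sum_nat_const card_ord muln1.
Qed.

End LKBasis.

(** * Coordinatewise verification of vector identities *)

Ltac lk_at :=
  lazymatch goal with
  | |- fun_of_fin (_ + _) _ = _ => eapply lk_atD; [lk_at | lk_at]
  | |- fun_of_fin (- _) _ = _ => eapply lk_atN; lk_at
  | |- fun_of_fin (_ *: _) _ = _ => eapply lk_atZ; lk_at
  | |- fun_of_fin 0 _ = _ => eapply lk0
  | |- _ => reflexivity
  end.

(* Coordinates are pushed to the atoms by unification: rewriting would try to
   unify every atom with a sum up to conversion. *)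
Ltac lk_coordinatewise :=
  let p := fresh "p" in apply: lk_ext => p;
  eapply lk_at_eq; [lk_at | lk_at | ];
  repeat match goal with |- context [fun_of_fin ?v p] =>
    move: (fun_of_fin v p) => ? end.

Ltac lk_field :=
  lk_coordinatewise; rewrite ?expr0; field; repeat (apply/andP; split); by [].

Section LKRewrite.
Variables (K : fieldType) (l r : K) (n : nat).
Local Notation m := (r^-1 - r).
Local Notation V := (lk_space K n).
Local Notation w := (lk_w K n).
Local Notation G := (lk_nu_fun l r).

Lemma lk_nuD i (u v : V) : G i (u + v) = G i u + G i v. Proof. exact: linearD. Qed.
Lemma lk_nu0 i : G i (0 : V) = 0. Proof. exact: linear0. Qed.
Lemma lk_nuN i (v : V) : G i (- v) = - G i v. Proof. exact: linearN. Qed.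
Lemma lk_nuZ i a (v : V) : G i (a *: v) = a *: G i v. Proof. exact: linearZ. Qed.

Lemma nu_i1k_sub i k : (i.+1 < k)%N -> (k < n)%N ->
  G i (w i.+1 k) = w i k + (m * r ^+ (k - i.+2)) *: w i i.+1 - m *: w i.+1 k.
Proof. by move=> ik kn; apply: nu_i1k; lia. Qed.

Lemma nu_si1_sub i s : (s < i)%N -> (i.+1 < n)%N ->
  G i (w s i.+1) = w s i + (m / (l * r ^+ (i - s.+1))) *: w i i.+1 - m *: w s i.+1.
Proof. by move=> ik kn; apply: nu_si1; lia. Qed.

End LKRewrite.

Ltac lk_nu_rewrite K l r n :=
  rewrite ?(lk_nuD, lk_nuN, lk_nuZ);
  repeat (first
    [ rewrite (@nu_diag K l r n); [|lia]
    | rewrite (@nu_si K l r n); [|lia|lia]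
    | rewrite (@nu_ik K l r n); [|lia|lia]
    | rewrite (@nu_i1k_sub K l r n); [|lia|lia]
    | rewrite (@nu_si1_sub K l r n); [|lia|lia]
    | rewrite (@nu_other K l r n); [|lia|lia|lia] ];
    rewrite ?(lk_nuD, lk_nuN, lk_nuZ)).

(** * Braid and commutation relations *)

Section LKRelations.
Variables (K : fieldType) (l r : K) (n : nat).
Hypotheses (l0 : l != 0) (r0 : r != 0).
Local Notation V := (lk_space K n).
Local Notation w := (lk_w K n).
Local Notation G := (lk_nu_fun l r).

Let rq d : r ^+ d != 0. Proof. by rewrite expf_neq0. Qed.

Lemma lk_nu_ext (F F' : V -> V) : linear F -> linear F' ->
  (forall s t, (s < t)%N -> (t < n)%N -> F (w s t) = F' (w s t)) -> F =1 F'.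
Proof.
move=> lF lF' FF' v.
have F0 (f : V -> V) : linear f -> f 0 = 0.
  move=> lf; have := lf (-1) 0 0; rewrite scaler0 addr0 => {1}->.
  by rewrite scaleN1r addNr.
have FD (f : V -> V) : linear f -> forall u v, f (u + v) = f u + f v.
  by move=> lf x y; have := lf 1 x y; rewrite !scale1r.
have FZ (f : V -> V) : linear f -> forall a u, f (a *: u) = a *: f u.
  by move=> lf a x; have := lf a x 0; rewrite !addr0 F0 // addr0.
elim/lk_w_ind: v => //.
- by rewrite !F0.
- by move=> u v eu ev; rewrite !FD // eu ev.
- by move=> a v ev; rewrite !FZ // ev.
Qed.

Lemma lk_nu_comp2_linear i j : linear (fun v : V => G i (G j v)).
Proof. by move=> a u v; rewrite !linearP. Qed.

Lemma lk_nu_comp3_linear i j k : linear (fun v : V => G i (G j (G k v))).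
Proof. by move=> a u v; rewrite !linearP. Qed.

Lemma lk_nu_braid i (v : V) : (i.+2 < n)%N ->
  G i (G i.+1 (G i v)) = G i.+1 (G i (G i.+1 v)).
Proof.
move=> ni; move: v; apply: lk_nu_ext; try exact: lk_nu_comp3_linear.
move=> s t st tn.
case: (ltnP s i) => si.
  (* Distances enter only through [r ^+ d] and [r ^+ d.+1]; once [r ^+ d] is generalised to a
     nonzero [q], every case is an identity of rational functions. *)
  have [d dE] : exists d, i = (s.+1 + d)%N by exists (i - s.+1)%N; lia.
  have e1 : (i - s.+1)%N = d by lia.
  have e2 : (i.+1 - s.+1)%N = d.+1 by lia.
  have caseP : (t < i)%N \/ (t = i \/ (t = i.+1 \/ (t = i.+2 \/ (i.+2 < t)%N))) by lia.
  case: caseP => [ti|[->|[->|[->|ti]]]];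
    lk_nu_rewrite K l r n; rewrite ?subnn ?e1 ?e2 ?exprS;
    move: (r ^+ d) (rq d) => q q0; lk_field.
case: (ltnP i.+2 t) => it; last first.
  have caseP : (s = i /\ t = i.+1) \/ ((s = i /\ t = i.+2) \/ (s = i.+1 /\ t = i.+2))
    by lia.
  case: caseP => [[-> ->]|[[-> ->]|[-> ->]]];
    lk_nu_rewrite K l r n; rewrite ?subnn ?expr0; lk_field.
have [d dE] : exists d, t = (i.+3 + d)%N by exists (t - i.+3)%N; lia.
have e1 : (t - i.+3)%N = d by lia.
have e2 : (t - i.+2)%N = d.+1 by lia.
have caseP : s = i \/ (s = i.+1 \/ (s = i.+2 \/ i.+2 < s)%N) by lia.
case: caseP => [->|[->|[->|si']]];
  lk_nu_rewrite K l r n; rewrite ?subnn ?e1 ?e2 ?exprS;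
  move: (r ^+ d) (rq d) => q q0; lk_field.
Qed.

Lemma lk_nu_commute i j (v : V) : (i.+1 < j)%N -> (j.+1 < n)%N ->
  G i (G j v) = G j (G i v).
Proof.
move=> ij jn; move: v; apply: lk_nu_ext; try exact: lk_nu_comp2_linear.
move=> s t st tn.
have [d dE] : exists d, j = (i.+2 + d)%N by exists (j - i.+2)%N; lia.
have e1 : (j - i.+1)%N = d.+1 by lia.
have e2 : (j - i.+2)%N = d by lia.
have e3 : (j.+1 - i.+2)%N = d.+1 by lia.
have caseP k : k = i \/ (k = i.+1 \/ (k = j \/ (k = j.+1 \/
   [&& k != i, k != i.+1, k != j & k != j.+1]))) by lia.
case: (caseP s) => [si|[si|[si|[si|si]]]]; case: (caseP t) => [ti|[ti|[ti|[ti|ti]]]];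
 rewrite ?si ?ti; rewrite ?si ?ti in st tn; try (exfalso; lia);
 lk_nu_rewrite K l r n; rewrite ?e1 ?e2 ?e3 ?exprS;
 repeat match goal with |- context [r ^+ ?a] => move: (r ^+ a) (rq a) => ? ? end;
 lk_field.
Qed.

End LKRelations.

(** * The Hecke relation on proper invariant subspaces *)

Section LKQuadratic.
Variables (K : fieldType) (l r : K) (n : nat).
Hypotheses (l0 : l != 0) (r0 : r != 0).
Local Notation m := (r^-1 - r).
Local Notation V := (lk_space K n).
Local Notation w := (lk_w K n).
Local Notation G := (lk_nu_fun l r).

Let rq d : r ^+ d != 0. Proof. by rewrite expf_neq0. Qed.

Lemma lk_nu_quadratic_mod i (v : V) : (i.+1 < n)%N ->
  exists c, G i (G i v) + m *: G i v = v + c *: w i i.+1.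
Proof.
move=> ni; elim/lk_w_ind: v => [|u v [a ea] [b eb]|a v [b eb]|s t st tn].
- by exists 0; rewrite !lk_nu0 scaler0 scale0r addr0.
- exists (a + b); rewrite !lk_nuD scalerDr addrACA ea eb addrACA.
  by rewrite scalerDl.
- exists (a * b); rewrite !lk_nuZ (scalerA m) [m * a]mulrC -(scalerA a m).
  by rewrite -scalerDr eb scalerDr scalerA.
have [[si ti]|[[ti si]|[[ti si]|[[si ti]|[[si ti]|so]]]]] :
    (s = i /\ t = i.+1) \/ ((t = i /\ s < i)%N \/ ((t = i.+1 /\ s < i)%N \/
    ((s = i /\ i.+1 < t)%N \/ ((s = i.+1 /\ i.+1 < t)%N \/
     [&& s != i, s != i.+1, t != i & t != i.+1])))) by lia.
- exists (l^-1 * l^-1 + m / l - 1); rewrite si ti; lk_nu_rewrite K l r n; lk_field.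
- exists (m / (l * r ^+ (i - s.+1))); rewrite ti; lk_nu_rewrite K l r n.
  move: (r ^+ _) (rq (i - s.+1)) => q q0; lk_field.
- exists (m / (l * r ^+ (i - s.+1)) / l); rewrite ti; lk_nu_rewrite K l r n.
  move: (r ^+ _) (rq (i - s.+1)) => q q0; lk_field.
- exists (m * r ^+ (t - i.+2)); rewrite si; lk_nu_rewrite K l r n.
  move: (r ^+ _) (rq (t - i.+2)) => q q0; lk_field.
- exists (m * r ^+ (t - i.+2) / l); rewrite si; lk_nu_rewrite K l r n.
  move: (r ^+ _) (rq (t - i.+2)) => q q0; lk_field.
- exists 0; lk_nu_rewrite K l r n; lk_field.
Qed.

Lemma lk_invariantP (W : {vspace V}) :
  lk_invariant l r W <-> forall i v, (i.+1 < n)%N -> v \in W -> G i v \in W.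
Proof.
split=> [WI i v ni vW|WI i].
  have ni' : (i < n.-1)%N by lia.
  have := memv_img (lk_nu l r (Ordinal ni')) vW; rewrite lfunE.
  exact: (subvP (WI _)).
apply/subvP => _ /memv_imgP[v vW ->]; rewrite lfunE /=; apply: WI => //.
by have := ltn_ord i; lia.
Qed.

(** [up] raises the second index, while [next] and [prev] shift the pair [i, i.+1] by one in either
    direction, so every basis vector is reached. *)
Lemma lk_invariant_w_full (W : {vspace V}) i :
    lk_invariant l r W -> (i.+1 < n)%N -> w i i.+1 \in W -> W = fullv.
Proof.
move=> /lk_invariantP WI ni wi.
have up s t k : (s < t)%N -> (t + k < n)%N -> w s t \in W -> w s (t + k)%N \in W.
  move=> st; elim: k => [|k ih] tk wst; first by rewrite addn0.
  rewrite addnS -(@nu_si K l r n); [|lia|lia].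
  by apply: (WI _ _ _ (ih _ wst)); lia.
have next j : (j.+2 < n)%N -> w j j.+1 \in W -> w j.+1 j.+2 \in W.
  move=> jn wj; rewrite -(@nu_ik K l r n); [|lia|lia].
  apply: WI; first lia.
  by rewrite -addn1; apply: up; rewrite ?addn1.
have prev j : (j.+2 < n)%N -> w j.+1 j.+2 \in W -> w j j.+1 \in W.
  move=> jn wj.
  have jn1 : (j.+1 < n)%N by lia.
  (* Adding [m *: w j.+1 j.+2] to its image under [G j] leaves [w j j.+2 + m *: w j j.+1], which
     [G j.+1] maps to [w j j.+1 + (m / l) *: w j.+1 j.+2]. *)
  have h1 := WI j _ jn1 wj.
  have h2 := WI j.+1 _ jn (memvD h1 (memvZ m wj)).
  have := memvB h2 (memvZ (m / l) wj).
  congr (_ \in W); lk_nu_rewrite K l r n; rewrite ?subnn; lk_field.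
have all_next j : (j.+1 < n)%N -> w j j.+1 \in W.
  have w0 : w 0 1 \in W.
    elim: i ni wi => [//|i ih] ni wi.
    by apply: ih; [lia | apply: prev].
  elim: j => [//|j ih] jn; apply: next => //; apply: ih; lia.
apply/eqP; rewrite eqEsubv subvf; apply/subvP => v _.
elim/lk_w_ind: v => [|u v|a v|s t st tn]; [exact: mem0v|exact: memvD|exact: memvZ|].
rewrite (_ : t = s.+1 + (t - s.+1))%N; last lia.
by apply: up; [lia|lia|apply: all_next; lia].
Qed.

Lemma lk_nu_quadratic (W : {vspace V}) i v :
    lk_invariant l r W -> W <> fullv -> (i.+1 < n)%N -> v \in W ->
  G i (G i v) + m *: G i v = v.
Proof.
move=> WI Wf ni vW; have [c cE] := lk_nu_quadratic_mod v ni.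
have [c0|c0] := eqVneq c 0; first by rewrite cE c0 scale0r addr0.
case: Wf; apply: (lk_invariant_w_full WI ni); move/lk_invariantP: WI => WI.
have : c *: w i i.+1 \in W.
  rewrite -(addrK v (c *: _)) [_ + v]addrC -cE memvB // memvD ?memvZ //; auto.
by move/(memvZ c^-1); rewrite scalerA mulVf // scale1r.
Qed.

End LKQuadratic.

(** * The operators [g_i - r] and the vector [Y] *)

Section LKSkew.
Variables (K : fieldType) (l r : K) (n : nat).
Hypotheses (l0 : l != 0) (r0 : r != 0) (n4 : (4 <= n)%N).
Local Notation V := (lk_space K n).
Local Notation w := (lk_w K n).
Local Notation G := (lk_nu_fun l r).

Definition lk_Y : V := w 1 3 - r *: w 0 3 - r *: w 1 2 + r ^+ 2 *: w 0 2.
(** The Hecke relation reads [(g_i + r^-1) (g_i - r) = 0]; where it holds, the image of this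
    operator consists of eigenvectors for [- r^-1]. *)
Definition lk_skew (i : nat) (v : V) : V := G i v - r *: v.
Local Notation h := lk_skew.

Lemma lk_skew_linear i : linear (h i).
Proof.
move=> a u v; rewrite /h linearP !scalerBr scalerDr opprD addrACA.
by rewrite !scalerA mulrC.
Qed.

HB.instance Definition _ i := GRing.isLinear.Build K V V _ (h i) (lk_skew_linear i).

Lemma lk_skewD i (u v : V) : h i (u + v) = h i u + h i v. Proof. exact: linearD. Qed.
Lemma lk_skewB i (u v : V) : h i (u - v) = h i u - h i v. Proof. exact: linearB. Qed.
Lemma lk_skewZ i a (v : V) : h i (a *: v) = a *: h i v. Proof. exact: linearZ. Qed.
Lemma lk_skew0 i : h i 0 = 0. Proof. exact: linear0. Qed.

(** Only the [w s t] with [s] in {0, 1} and [t] in {2, 3} have a nonzero image; every other basis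
    vector is killed by the product. *)
Lemma lk_skew_skew v : exists c, h 2 (h 0 v) = c *: lk_Y.
Proof.
elim/lk_w_ind: v => [|u v [a ea] [b eb]|a v [b eb]|s t st tn].
- by exists 0; rewrite !lk_skew0 scale0r.
- by exists (a + b); rewrite (lk_skewD 0) (lk_skewD 2) ea eb scalerDl.
- by exists (a * b); rewrite (lk_skewZ 0) (lk_skewZ 2) eb scalerA.
have [s2|s2] := leqP 2 s.
  exists 0; rewrite /h [G 0 _](@nu_other K l r n) //; last lia.
  by rewrite subrr lk_nu0 scaler0 subrr scale0r.
have [[-> ->]|[[-> ->]|[[-> ->]|[[-> t3]|[[-> ->]|[[-> ->]|[-> t3]]]]]]] :
   (s = 0 /\ t = 1) \/ ((s = 0 /\ t = 2) \/ ((s = 0 /\ t = 3) \/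
   ((s = 0 /\ 3 < t) \/ ((s = 1 /\ t = 2) \/ ((s = 1 /\ t = 3) \/
    (s = 1 /\ 3 < t))))))%N by lia.
- exists 0; rewrite /h /lk_Y; lk_nu_rewrite K l r n; lk_field.
- exists 1; rewrite /h /lk_Y; lk_nu_rewrite K l r n; lk_field.
- exists (- r^-1); rewrite /h /lk_Y; lk_nu_rewrite K l r n; rewrite ?subnn ?expr0; lk_field.
- exists 0; rewrite /h /lk_Y; lk_nu_rewrite K l r n; lk_field.
- exists (- r^-1); rewrite /h /lk_Y; lk_nu_rewrite K l r n; rewrite ?subnn ?expr0; lk_field.
- exists (r^-1 * r^-1); rewrite /h /lk_Y; lk_nu_rewrite K l r n.
  by rewrite ?subnn ?expr0 (_ : (3 - 2)%N = 1%N) //; lk_field.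
- exists 0; rewrite /h /lk_Y; lk_nu_rewrite K l r n.
  move: (r ^+ _) => q; lk_field.
Qed.

(** [Y] is an eigenvector of both [G 0] and [G 2] for [- r^-1]. *)
Lemma lk_skew_Y : h 2 (h 0 lk_Y) = (r + r^-1) ^+ 2 *: lk_Y.
Proof.
rewrite /h /lk_Y; lk_nu_rewrite K l r n; rewrite ?subnn ?expr0 (_ : (3 - 2)%N = 1%N) //.
lk_field.
Qed.

End LKSkew.

(** * Invariant subspaces containing [Y] *)

Section LKGenerated.
Variables (K : fieldType) (l r : K) (n : nat).
Hypotheses (l0 : l != 0) (r0 : r != 0) (n4 : (4 <= n)%N).
Local Notation m := (r^-1 - r).
Local Notation V := (lk_space K n).
Local Notation w := (lk_w K n).
Local Notation G := (lk_nu_fun l r).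

Lemma lk_coord_Y : lk_coord 1 3 (lk_Y r n) = 1.
Proof.
rewrite /lk_Y !(linearB, linearD, linearZ) /= !lk_coord_w //=.
by rewrite !mulr0 !subr0 addr0.
Qed.

Lemma lk_Y_neq0 : lk_Y r n != 0.
Proof.
by apply: contra_eq_neq lk_coord_Y => ->; rewrite linear0 eq_sym oner_eq0.
Qed.

Lemma lk_Y_invariant_param (W : {vspace V}) :
    lk_invariant l r W -> W <> fullv -> lk_Y r n \in W -> l = r \/ l = - r ^+ 3.
Proof.
move=> WI Wf YW.
have /eqP := lk_nu_quadratic l0 r0 (i := 1) WI Wf (ltnW n4) YW.
rewrite -subr_eq0 => /eqP/(congr1 (lk_coord 1 2)).
have -> : G 1 (G 1 (lk_Y r n)) + m *: G 1 (lk_Y r n) - lk_Y r n =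
    ((l - r) * (l + r ^+ 3) / (r * l ^+ 2)) *: w 1 2.
  by rewrite /lk_Y; lk_nu_rewrite K l r n; rewrite ?subnn ?expr0; lk_field.
rewrite linearZ /= lk_coord_w //; [|exact: ltnW n4]; rewrite linear0 /= mulr1 => /eqP.
have d0 : r * l ^+ 2 != 0 by rewrite mulf_neq0 // expf_neq0.
rewrite mulf_eq0 invr_eq0 (negPf d0) orbF mulf_eq0.
by case/orP => [|]; [rewrite subr_eq0 => /eqP; left | rewrite addr_eq0 => /eqP; right].
Qed.

(* Modulo U, the vectors of X span everything, because g_j maps w_{j,k} to w_{j+1,k}. *)
Lemma lk_spread (U : {vspace V}) (X : seq V) :
    lk_invariant l r U ->
    (forall k, (0 < k < n)%N -> w 0 k \in (U + <<X>>)%VS) ->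
    (forall k, (1 < k < n)%N -> w 1 k \in (U + <<X>>)%VS) ->
    (forall j x, (0 < j)%N -> (j.+1 < n)%N -> x \in X ->
       w j j.+1 \in (U + <<X>>)%VS -> G j x \in (U + <<X>>)%VS) ->
  ('C(n, 2) <= \dim U + size X)%N.
Proof.
move=> /lk_invariantP UI w0 w1 GX.
have GT j y : (0 < j)%N -> (j.+1 < n)%N -> w j j.+1 \in (U + <<X>>)%VS ->
    y \in (U + <<X>>)%VS -> G j y \in (U + <<X>>)%VS.
  move=> j0 jn wj /memv_addP[u uU [x xX ->]].
  rewrite lk_nuD memvD //; first by apply: (subvP (addvSl _ _)); apply: UI.
  have jn' : (j < n.-1)%N by lia.
  rewrite -(lfunE (lk_nu_fun l r j)).
  have := memv_img (linfun (lk_nu_fun l r j)) xX; rewrite limg_span.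
  apply: subvP; apply/span_subvP => _ /mapP[x' x'X ->].
  by rewrite lfunE; apply: GX.
have wjk j k : (j < k)%N -> (k < n)%N -> w j k \in (U + <<X>>)%VS.
  elim: j k => [|[|j] ih] k jk kn.
  - by apply: w0; lia.
  - by apply: w1; lia.
  - rewrite -(@nu_ik K l r n); [|lia|lia].
    by apply: GT; [lia|lia|apply: ih; lia|apply: ih; lia].
have full : (fullv <= U + <<X>>)%VS.
  apply/subvP => v _.
  elim/lk_w_ind: v => [|u v|a v|s t st tn]; [exact: mem0v|exact: memvD|exact: memvZ|].
  exact: wjk.
rewrite -(dim_lk_space K); apply: leq_trans (dimvS full) _.
apply: leq_trans (dimv_add_leqif _ _) _.
by rewrite leq_add2l dim_span.
Qed.

Definition lk_row0 : seq V := [seq w 0 k | k <- iota 1 n.-1].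

Lemma lk_row0_mem k : (0 < k < n)%N -> w 0 k \in lk_row0.
Proof. by move=> kn; apply: map_f; rewrite mem_iota; lia. Qed.

Lemma size_lk_row0 : size lk_row0 = n.-1.
Proof. by rewrite size_map size_iota. Qed.

Lemma lk_nu_row0 (T : {vspace V}) j x : (0 < j)%N -> (j.+1 < n)%N ->
    (forall k, (0 < k < n)%N -> w 0 k \in T) -> w j j.+1 \in T -> x \in lk_row0 ->
  G j x \in T.
Proof.
move=> j0 jn w0 wj /mapP[k]; rewrite mem_iota => kn ->.
have [->|[->|kj]] : k = j \/ (k = j.+1 \/ (k != j) && (k != j.+1)) by lia.
- by lk_nu_rewrite K l r n; apply: w0; lia.
- lk_nu_rewrite K l r n; apply: memvB; last by apply: memvZ; apply: w0; lia.
  by apply: memvD; [apply: w0; lia | apply: memvZ].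
- by lk_nu_rewrite K l r n; apply: memvZ; apply: w0; lia.
Qed.

(** Modulo [U], each [w 1 k] with [2 < k] is a combination of [w 0 k], [w 0 2] and [w 1 2], so
    [lk_spread] applies to the row [w 0 k] together with [w 1 2]. *)
Lemma lk_Y_dim (U : {vspace V}) : lk_invariant l r U -> lk_Y r n \in U ->
  ('C(n, 2) <= \dim U + n)%N.
Proof.
move=> UI YU; have UG := (lk_invariantP l0 r0 U).1 UI.
(* For [d = 0] this is [Y]; applying [G d.+3] raises the index and multiplies the part in [w 1 2]
   and [w 0 2] by [r]. *)
have Yk d : (d.+3 < n)%N ->
    w 1 d.+3 - r *: w 0 d.+3 - r ^+ d.+1 *: (w 1 2 - r *: w 0 2) \in U.
  elim: d => [|d ih] dn.
    by move: YU; congr (_ \in U); rewrite /lk_Y; lk_field.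
  have dn' : (d.+3 < n)%N by lia.
  have := UG d.+3 _ dn (ih dn'); congr (_ \in U); lk_nu_rewrite K l r n.
  by rewrite ![in RHS]exprS exprS; move: (r ^+ d) => q; lk_field.
pose X := w 1 2 :: lk_row0.
have sX : size X = n by rewrite /= size_lk_row0; lia.
suff : ('C(n, 2) <= \dim U + size X)%N by rewrite sX.
have XT x : x \in X -> x \in (U + <<X>>)%VS.
  by move=> xX; apply: (subvP (addvSr _ _)); apply: memv_span.
have w0 k : (0 < k < n)%N -> w 0 k \in (U + <<X>>)%VS.
  by move=> kn; apply: XT; rewrite inE lk_row0_mem // orbT.
have w12 : w 1 2 \in (U + <<X>>)%VS by apply: XT; rewrite inE eqxx.
have w1 k : (1 < k < n)%N -> w 1 k \in (U + <<X>>)%VS.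
  move=> kn; have [->//|k2] := eqVneq k 2.
  have [d dE] : exists d, k = d.+3 by exists (k - 3)%N; lia.
  have dn : (d.+3 < n)%N by lia.
  have yU := subvP (addvSl U <<X>>%VS) _ (Yk d dn).
  have w02 := w0 2 (ltnW n4).
  have := memvD (memvD yU (memvZ (r ^+ d.+1) (memvB w12 (memvZ r w02))))
                (memvZ r (w0 d.+3 dn)).
  by rewrite dE; congr (_ \in (U + <<X>>)%VS); move: (r ^+ d.+1) => q; lk_field.
apply: lk_spread => // j x j0 jn.
rewrite inE => /orP[/eqP->|xX] wj; last exact: lk_nu_row0.
have [->|[->|j2]] : j = 1 \/ (j = 2 \/ 2 < j)%N by lia.
- by rewrite nu_diag; [apply: memvZ | lia].
- by rewrite (@nu_si K l r n); [apply: w1; lia | lia | lia].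
- by lk_nu_rewrite K l r n; apply: memvZ.
Qed.

Lemma lk_Y_dim_minus (U : {vspace V}) : l = - r ^+ 3 -> 1 + r ^+ 2 != 0 ->
  lk_invariant l r U -> lk_Y r n \in U -> ('C(n, 2) <= \dim U + n.-1)%N.
Proof.
move=> lr r2 UI YU; have UG := (lk_invariantP l0 r0 U).1 UI.
have r2' : r + r^-1 != 0.
  by apply: contra r2 => /eqP e; rewrite -(mulr0 r) -e; apply/eqP; field.
have n1 : (1 < n)%N by lia.
have n2 : (2 < n)%N by lia.
have zU : w 1 2 - r *: w 0 2 + r ^+ 2 *: w 0 1 \in U.
  have Y1 := UG 1 _ n2 YU; have Y0 := UG 0 _ n1 Y1.
  have r2N : - (r + r^-1) != 0 by rewrite oppr_eq0.
  suff /(memvZ (- (r + r^-1))^-1) :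
      - (r + r^-1) *: (w 1 2 - r *: w 0 2 + r ^+ 2 *: w 0 1) \in U.
    by rewrite scalerA mulVf // scale1r.
  (* With [l = - r ^+ 3], the vector [(g_0 - r) g_1 Y + r ^+ 2 *: Y] is [- (r + r^-1)] times the one
     sought. *)
  have := memvD (memvB Y0 (memvZ r Y1)) (memvZ (r ^+ 2) YU).
  congr (_ \in U); rewrite /lk_Y; lk_nu_rewrite K l r n; rewrite ?subnn ?expr0.
  have l0' := l0; rewrite lr in l0' *; lk_field.
have zk d : (d.+2 < n)%N -> w 1 d.+2 - r *: w 0 d.+2 + r ^+ d.+2 *: w 0 1 \in U.
  elim: d => [//|d ih] dn.
  have dn' : (d.+2 < n)%N by lia.
  have := UG d.+2 _ dn (ih dn'); congr (_ \in U); lk_nu_rewrite K l r n.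
  by rewrite !exprS; move: (r ^+ d) => q; lk_field.
rewrite -size_lk_row0; set X := lk_row0.
have w0 k : (0 < k < n)%N -> w 0 k \in (U + <<X>>)%VS.
  move=> kn; apply: (subvP (addvSr _ _)); apply: memv_span; exact: lk_row0_mem.
apply: lk_spread => // [k kn|j x j0 jn xX wj]; last exact: lk_nu_row0.
have [d dE] : exists d, k = d.+2 by exists (k - 2)%N; lia.
have dn : (d.+2 < n)%N by lia.
have zU' := subvP (addvSl U <<X>>%VS) _ (zk d dn).
have := memvD (memvB zU' (memvZ (r ^+ d.+2) (w0 1 n1))) (memvZ r (w0 d.+2 dn)).
by rewrite dE; congr (_ \in (U + <<X>>)%VS); move: (r ^+ d.+2) => q; lk_field.
Qed.

End LKGenerated.

(** * Coordinates of images under the generators *)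

Section LKCoordinates.
Variables (K : fieldType) (l r : K) (n : nat).
Hypotheses (l0 : l != 0) (r0 : r != 0) (n4 : (4 <= n)%N).
Local Notation m := (r^-1 - r).
Local Notation V := (lk_space K n).
Local Notation G := (lk_nu_fun l r).
Local Notation h := (lk_skew l r).
Local Notation cf := (lk_coord (K := K) (n := n)).

Lemma lk_coordD s t (u v : V) : cf s t (u + v) = cf s t u + cf s t v.
Proof. exact: linearD. Qed.
Lemma lk_coordN s t (v : V) : cf s t (- v) = - cf s t v.
Proof. exact: linearN. Qed.
Lemma lk_coordZ s t a (v : V) : cf s t (a *: v) = a * cf s t v.
Proof. exact: linearZ. Qed.
Lemma lk_coord0 s t : cf s t (0 : V) = 0.
Proof. exact: linear0. Qed.

(** If [g_j v = r v], this gives [cf 1 j v = r^-1 * cf 1 j.+1 v]. The condition [1 < j] keeps the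
    extra term [w j j.+1] away from the coordinates [w 1 k]. *)
Lemma lk_coord_nu j (v : V) : (1 < j)%N -> (j.+1 < n)%N ->
  cf 1 j.+1 (G j v) = cf 1 j v - m * cf 1 j.+1 v.
Proof.
move=> j1 jn.
elim/lk_w_ind: v => [|u v eu ev|a v ev|s t st tn].
- by rewrite lk_nu0 !lk_coord0; ring.
- by rewrite lk_nuD !lk_coordD eu ev; ring.
- by rewrite lk_nuZ !lk_coordZ ev; ring.
rewrite lk_nu_fun_w // /lk_nu_w.
repeat case: ifP => ?; rewrite ?(lk_coordD, lk_coordN, lk_coordZ) !lk_coord_w; try lia;
 repeat (case: eqP => //= ?); try lia; ring.
Qed.

(** Modulo [w 0 1], the operator [h 0] sends [w 0 k] and [w 1 k] to multiples of
    [w 1 k - r *: w 0 k]. *)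
Lemma lk_coord_skew0 k (v : V) : (1 < k)%N -> (k < n)%N ->
  cf 0 k (h 0 v) = - r * cf 1 k (h 0 v).
Proof.
move=> k1 kn.
elim/lk_w_ind: v => [|u v eu ev|a v ev|s t st tn].
- by rewrite lk_skew0 !lk_coord0; ring.
- by rewrite lk_skewD (lk_coordD 0 k) (lk_coordD 1 k) eu ev; ring.
- by rewrite lk_skewZ (lk_coordZ 0 k) (lk_coordZ 1 k) ev; ring.
rewrite /lk_skew lk_nu_fun_w // /lk_nu_w.
repeat case: ifP => ?; rewrite ?(lk_coordD, lk_coordN, lk_coordZ) !lk_coord_w; try lia;
 repeat (case: eqP => //= ?); try lia; by field.
Qed.

Lemma lk_coord_skew0_eq0 s t (v : V) : (1 < s)%N -> (s < t)%N -> (t < n)%N ->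
  cf s t (h 0 v) = 0.
Proof.
move=> s1 st tn.
elim/lk_w_ind: v => [|u v eu ev|a v ev|s' t' st' tn'].
- by rewrite lk_skew0 !lk_coord0; ring.
- by rewrite lk_skewD (lk_coordD s t) eu ev; ring.
- by rewrite lk_skewZ (lk_coordZ s t) ev; ring.
rewrite /lk_skew lk_nu_fun_w // /lk_nu_w.
repeat case: ifP => ?; rewrite ?(lk_coordD, lk_coordN, lk_coordZ) !lk_coord_w; try lia;
 repeat (case: eqP => //= ?); try lia; ring.
Qed.

End LKCoordinates.

Lemma dim_le1 (K : fieldType) (V : vectType K) (f : {scalar V}) (I : {vspace V}) :
  (forall x, x \in I -> f x = 0 -> x = 0) -> (\dim I <= 1)%N.
Proof.
move=> fI; have [->|I0] := eqVneq I 0%VS; first by rewrite dimv0.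
have xI := memv_pick I; set x := vpick I in xI.
have x0 : x != 0 by rewrite vpick0.
have fx : f x != 0 by apply: contra_neq x0 => /(fI _ xI).
suff /dimvS : (I <= <[x]>)%VS by move=> /leq_trans; apply; rewrite dim_vline leq_b1.
apply/subvP => y yI; apply/vlineP; exists (f y / f x).
apply/eqP; rewrite -subr_eq0; apply/eqP/fI; first by rewrite memvB // memvZ.
by rewrite linearB linearZ /= divfK // subrr.
Qed.

Lemma dim_limg_le (K : fieldType) (V V' : vectType K) (f : 'Hom(V, V')) U :
  (\dim (f @: U) <= \dim U)%N.
Proof. by rewrite -(limg_ker_dim f U) leq_addl. Qed.

(** * Invariant subspaces avoiding [Y] *)

Section LKSmall.
Variables (K : fieldType) (l r : K) (n : nat).
Hypotheses (l0 : l != 0) (r0 : r != 0) (n4 : (4 <= n)%N).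
Local Notation m := (r^-1 - r).
Local Notation V := (lk_space K n).
Local Notation w := (lk_w K n).
Local Notation G := (@lk_nu_fun K l r n).
Local Notation h := (@lk_skew K l r n).
Local Notation cf := (lk_coord (K := K) (n := n)).
Local Notation d := (r + r^-1).

Variable W : {vspace V}.
Hypotheses (WI : lk_invariant l r W) (Wf : W <> fullv) (YW : lk_Y r n \notin W).
Hypothesis W0 : forall v, v \in W ->
  (forall i, (i.+1 < n)%N -> h i v = 0) -> v = 0.

Let GW i v : (i.+1 < n)%N -> v \in W -> G i v \in W.
Proof. by move=> ni vW; apply: (lk_invariantP l0 r0 W).1. Qed.

Let hW i v : (i.+1 < n)%N -> v \in W -> h i v \in W.
Proof. by move=> ni vW; rewrite memvB ?memvZ ?GW. Qed.

Let quad i v : (i.+1 < n)%N -> v \in W -> G i (G i v) + m *: G i v = v.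
Proof. exact: lk_nu_quadratic. Qed.

(** By the Hecke relation, [g_i + m] inverts [g_i] on [W]. *)
Let G_surj i v : (i.+1 < n)%N -> v \in W -> exists2 u, u \in W & v = G i u.
Proof.
move=> ni vW; exists (G i v + m *: v); first by rewrite memvD ?memvZ ?GW.
by rewrite lk_nuD lk_nuZ quad.
Qed.

Let h_h i v : (i.+1 < n)%N -> v \in W -> h i (h i v) = - d *: h i v.
Proof.
move=> ni vW; have e := quad ni vW; rewrite /lk_skew lk_nuD lk_nuN lk_nuZ.
rewrite (canRL (addrK _) e).
lk_field.
Qed.

Let h_conj i v : (i.+2 < n)%N -> h i.+1 (G i (G i.+1 v)) = G i (G i.+1 (h i v)).
Proof.
move=> ni; by rewrite /lk_skew -(lk_nu_braid l0 r0 v ni) !(lk_nuD, lk_nuN, lk_nuZ).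
Qed.

(** Expand the braid relation in [g = h + r]: the mixed quadratic terms cancel, the squares become
    linear by [h_h], and [r * d - r ^+ 2 = 1] is the remaining coefficient. *)
Let h_braid i v : (i.+2 < n)%N -> v \in W ->
  h i (h i.+1 (h i v)) - h i v = h i.+1 (h i (h i.+1 v)) - h i.+1 v.
Proof.
move=> ni vW; have ni' : (i.+1 < n)%N by lia.
rewrite /lk_skew !(lk_nuD, lk_nuN, lk_nuZ) (lk_nu_braid l0 r0 v ni).
have q1 := quad ni' vW; have q2 := quad ni vW.
rewrite (canRL (addrK _) q1) (canRL (addrK _) q2).
lk_field.
Qed.

Let h_comm j v : (1 < j)%N -> (j.+1 < n)%N -> h j (h 0 v) = h 0 (h j v).
Proof.
move=> j1 jn; rewrite /lk_skew !(lk_nuD, lk_nuN, lk_nuZ).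
by rewrite (@lk_nu_commute K l r n l0 r0 0 j v j1 jn); lk_field.
Qed.

(* Conjugation by g_j g_{j+1} moves the vanishing from j = 2 to all j >= 2. *)
Let h_zero j v : (1 < j)%N -> (j.+1 < n)%N -> v \in W -> h j (h 0 v) = 0.
Proof.
have h20 u : u \in W -> h 2 (h 0 u) = 0.
  move=> uW; have [c cE] := lk_skew_skew l0 r0 n4 u.
  have [c0|c0] := eqVneq c 0; first by rewrite cE c0 scale0r.
  case/negP: YW; have : c *: lk_Y r n \in W by rewrite -cE !hW //; lia.
  by move/(memvZ c^-1); rewrite scalerA mulVf // scale1r.
elim: j v => [//|[//|[|j] ih]] v _ jn vW; first exact: h20.
have jn1 : (j.+3 < n)%N by lia.
have [u uW ->] := G_surj jn1 vW; have [x xW ->] := G_surj jn uW.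
rewrite h_comm // (h_conj _ jn).
have G0 y : h 0 (G j.+2 (G j.+3 y)) = G j.+2 (G j.+3 (h 0 y)).
  rewrite /lk_skew !(lk_nuD, lk_nuN, lk_nuZ).
  rewrite (lk_nu_commute l0 r0 (i := 0) (j := j.+2) _ isT jn1).
  by rewrite (lk_nu_commute l0 r0 (i := 0) (j := j.+3) y isT jn).
by rewrite G0 -h_comm // ih // !lk_nu0.
Qed.

(* Being killed by g_j - r for j >= 2 forces the coefficients of x at the w_{1,k} to be
   in geometric progression, so a vanishing first coefficient leaves a multiple of
   w_{0,1}. *)
Let h0_inj x v : v \in W -> x = h 0 v -> cf 1 2 x = 0 -> x = 0.
Proof.
move=> vW xE x12.
have n0 : (1 < n)%N by lia.
have xW : x \in W by rewrite xE hW.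
have x1 j : (1 < j)%N -> (j < n)%N -> cf 1 j x = 0.
  elim: j => [//|[//|[//|j] ih]] _ jn.
  have := congr1 (cf 1 j.+3) (h_zero (isT : (1 < j.+2)%N) jn vW).
  rewrite -xE /lk_skew lk_coordD lk_coordN lk_coordZ lk_coord_nu // lk_coord0.
  rewrite ih // => [e|]; last lia.
  have : - r^-1 * cf 1 j.+3 x = 0 by rewrite -[RHS]e; ring.
  by move/eqP; rewrite mulf_eq0 oppr_eq0 invr_eq0 (negPf r0) => /eqP.
have x01 : x = cf 0 1 x *: w 0 1.
  apply/eqP; rewrite -subr_eq0; apply/eqP/lk_coord_eq0 => s t st tn.
  rewrite lk_coordD lk_coordN lk_coordZ lk_coord_w //.
  have [s2|[s1|[s0|[-> ->]]]] :
    (1 < s \/ (s = 1 \/ (s = 0 /\ 1 < t \/ s = 0 /\ t = 1)))%N by lia.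
  - rewrite xE (lk_coord_skew0_eq0 l0 r0) // (_ : (s == 0) = false); last lia.
    by rewrite mulr0 subr0.
  - rewrite s1 x1 //=; [by rewrite mulr0 subr0 | lia].
  - case: s0 => s0 t1; rewrite s0 xE (lk_coord_skew0 l0 r0) // -xE x1 //.
    by rewrite mulr0 (_ : (t == 1) = false) ?mulr0 ?subr0 //; lia.
  - by rewrite mulr1 subrr.
have [e|e] := eqVneq (cf 0 1 x) 0; first by rewrite x01 e scale0r.
case: Wf; apply: (lk_invariant_w_full l0 r0 WI n0).
by move: xW; rewrite x01 => /(memvZ (cf 0 1 x)^-1); rewrite scalerA mulVf // scale1r.
Qed.

Local Notation H i := (linfun (h i)).

(** By [h0_inj], the coordinate at [w 1 2] is injective on the image of [h 0]; conjugation by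
    [g_i g_{i+1}] ([h_conj]) carries the bound from [i] to [i.+1]. *)
Lemma lk_skew_rank i : (i.+1 < n)%N -> (\dim (H i @: W) <= 1)%N.
Proof.
elim: i => [|i ih] ni.
  apply: (@dim_le1 _ _ (lk_coord 1 2)) => _ /memv_imgP[v vW ->]; rewrite lfunE.
  exact: (h0_inj vW).
have ni' : (i.+1 < n)%N by lia.
apply: leq_trans (ih ni'); rewrite -/(H i).
apply: leq_trans (dim_limg_le (linfun (G i) \o linfun (G i.+1)) _); apply: dimvS.
apply/subvP => _ /memv_imgP[v vW ->]; rewrite lfunE /=.
have [u uW ->] := G_surj ni' vW; have [x xW ->] := G_surj ni uW.
rewrite h_conj // -[h i x]lfunE -(lfunE (G i.+1)) -(lfunE (G i)) -comp_lfunE.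
by apply: memv_img; apply: memv_img.
Qed.

(** Each of the [n.-1] kernels lowers the dimension by at most one, and their intersection in [W] is
    zero by [W0]. *)
Lemma lk_small_dim : (\dim W <= n.-1)%N.
Proof.
pose Wk := fix Wk k := if k is k'.+1 then (Wk k' :&: lker (H k'))%VS else W.
have WkW k : (Wk k <= W)%VS.
  by elim: k => [|k ih] /=; [exact: subvv | apply: subv_trans ih; exact: capvSl].
have Wkh k i v : (i < k)%N -> v \in Wk k -> h i v = 0.
  elim: k => [//|k ih] /=; rewrite ltnS leq_eqVlt memv_cap => /orP[/eqP->|ik] /andP[vk].
    by rewrite memv_ker lfunE => /eqP.
  by move=> _; apply: ih.
have dimWk k : (k < n)%N -> (\dim W <= \dim (Wk k) + k)%N.
  elim: k => [|k ih] kn; first by rewrite addn0.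
  apply: leq_trans (ih (ltnW kn)) _.
  rewrite -(limg_ker_dim (H k) (Wk k)) /= -addnA leq_add2l addnC -addn1 leq_add2l.
  by apply: leq_trans (lk_skew_rank kn); apply/dimvS/limgS.
have nn : (n.-1 < n)%N by lia.
apply: leq_trans (dimWk _ nn) _.
suff -> : Wk n.-1 = 0%VS by rewrite dimv0.
apply/eqP; rewrite -subv0; apply/subvP => v vk; rewrite memv0; apply/eqP/W0.
  exact: (subvP (WkW _)) vk.
by move=> i ni; apply: Wkh vk; lia.
Qed.

Let image_line i y : (i.+1 < n)%N -> y \in (H i @: W)%VS -> y != 0 ->
  forall v, v \in W -> exists a, h i v = a *: y.
Proof.
move=> ni yI y0 v vW.
have hvI : h i v \in (H i @: W)%VS by rewrite -(lfunE (h i)) memv_img.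
have /eqP yE : (<[y]> == H i @: W)%VS.
  by rewrite eqEdim dim_vline y0 lk_skew_rank // andbT -memvE.
by move: hvI; rewrite -yE => /vlineP.
Qed.

Let nonzero_image i u : (i.+1 < n)%N -> u \in W -> h i u != 0 ->
  [/\ h i u \in W, h i (h i u) = - d *: h i u &
    forall v, v \in W -> exists a, h i v = a *: h i u].
Proof.
move=> ni uW hu; split=> //; [exact: hW|exact: h_h|].
by apply: image_line => //; rewrite -(lfunE (h i)) memv_img.
Qed.

Hypothesis d0 : d != 0.

(* Writing y_i for a generator of (g_i - r) W, the braid relations applied to y_0 and y_2
   determine the products of the coefficients of y_1 and of g_1 - r in the basis
   y_0, y_2. *)
Lemma lk_small_four : n = 4 -> \dim W = 2 -> d ^+ 2 = 2.
Proof.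
move=> n_4 dW.
have n0 : (1 < n)%N by lia.
have n1 : (2 < n)%N by lia.
have n2 : (3 < n)%N by lia.
(* By [h_braid], if [h i] vanishes on [W] then so do its neighbours; were one of the three zero, all
   would be, contradicting [W0] since [W] is nonzero. *)
pose Z i := forall u, u \in W -> h i u = 0.
have Zup j : (j.+2 < n)%N -> Z j -> Z j.+1.
  move=> jn hj u uW; have := h_braid jn uW.
  rewrite (hj u uW) (hj (h j.+1 u)) ?hW // !lk_skew0 subr0 sub0r.
  by move/eqP; rewrite eq_sym oppr_eq0 => /eqP.
have Zdown j : (j.+2 < n)%N -> Z j.+1 -> Z j.
  move=> jn hj u uW; have jn' : (j.+1 < n)%N by lia.
  have := h_braid jn uW.
  rewrite (hj u uW) (hj (h j u)) ?hW // !lk_skew0 subr0 sub0r.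
  by move/eqP; rewrite oppr_eq0 => /eqP.
have nZ1 : ~ Z 1.
  move=> Z1; have Z0 := Zdown 0 n1 Z1; have Z2 := Zup 1 n2 Z1.
  suff W00 : W = 0%VS by move: dW; rewrite W00 dimv0.
  apply/eqP; rewrite -subv0; apply/subvP => v vW; rewrite memv0; apply/eqP/W0 => // i ni.
  have [->|[->|->]] : i = 0 \/ (i = 1 \/ i = 2) by lia.
  - exact: Z0.
  - exact: Z1.
  - exact: Z2.
have nz i : ~ Z i -> exists2 u, u \in W & h i u != 0.
  move=> nZ; have [//|no] := pselect (exists2 u, u \in W & h i u != 0).
  by case: nZ => u uW; apply/eqP/negPn/negP => hu; apply: no; exists u.
have [u1 u1W y10] := nz 1 nZ1; have [y1W hy1 im1] := nonzero_image n1 u1W y10.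
have [u0 u0W y00] := nz 0 (fun z => nZ1 (Zup 0 n1 z)).
have [y0W hy0 _] := nonzero_image n0 u0W y00.
have [u2 u2W y20] := nz 2 (fun z => nZ1 (Zdown 1 n2 z)).
have [y2W hy2 _] := nonzero_image n2 u2W y20.
have h2y0 : h 2 (h 0 u0) = 0 by apply: h_zero.
have h0y2 : h 0 (h 2 u2) = 0 by rewrite -(@h_comm 2 u2 isT n2); apply: h_zero.
move: (h 0 u0) (h 1 u1) (h 2 u2) y00 y10 y20 y0W y1W y2W hy0 hy1 hy2 h2y0 h0y2 im1.
move=> y0 y1 y2 y00 y10 y20 y0W y1W y2W hy0 hy1 hy2 h2y0 h0y2 im1.
have [al [be y1E]] : exists al be, y1 = al *: y0 + be *: y2.
  (* [h 0] kills [y2] but not [y0], so the two are independent and span the plane [W]. *)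
  have fr : free [:: y0; y2].
    rewrite free_cons span_seq1 seq1_free y20 andbT; apply/vlineP => -[k y0E].
    move/eqP: hy0; rewrite {1}y0E lk_skewZ h0y2 scaler0 eq_sym scaler_eq0 oppr_eq0.
    by rewrite (negPf d0) (negPf y00).
  have : y1 \in <<[:: y0; y2]>>%VS.
    have /eqP -> // : (<<[:: y0; y2]>> == W)%VS.
    rewrite eqEdim dW (eqnP fr) leqnn andbT; apply/span_subvP => x.
    by rewrite !inE => /orP[] /eqP->.
  rewrite span_cons span_seq1 => /memv_addP[_ /vlineP[al ->] [_ /vlineP[be ->] ->]].
  by exists al, be.
have [a h1y0] := im1 _ y0W; have [b h1y2] := im1 _ y2W.
have cancel c : c *: y1 = 0 -> c = 0.
  by move/eqP; rewrite scaler_eq0 (negPf y10) orbF => /eqP.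
have h0y1 : h 0 y1 = (- d * al) *: y0.
  by rewrite y1E lk_skewD !lk_skewZ hy0 h0y2 scaler0 addr0 scalerA mulrC.
have h2y1 : h 2 y1 = (- d * be) *: y2.
  by rewrite y1E lk_skewD !lk_skewZ hy2 h2y0 scaler0 add0r scalerA mulrC.
have sum : al * a + be * b = - d.
  apply/eqP; rewrite -subr_eq0; apply/eqP/cancel.
  rewrite scalerBl -hy1 {2}y1E lk_skewD !lk_skewZ h1y0 h1y2 !scalerA -scalerDl.
  by rewrite subrr.
(* This is the braid relation of [h 0] and [h 1] at [y2], which [h 0] kills; [ea] is its mirror
   image at [y0]. *)
have eb : b * (1 + d * (a * al)) = 0.
  apply: cancel; have := h_braid n1 y2W.
  rewrite h0y2 !lk_skew0 subrr h1y2 !lk_skewZ h0y1 lk_skewZ h1y0.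
  rewrite !scalerA -scalerBl => e; rewrite -[RHS]oppr0 [in RHS]e -scaleNr.
  by congr (_ *: _); ring.
have ea : a * (1 + d * (b * be)) = 0.
  apply: cancel; have := h_braid n2 y0W.
  rewrite h2y0 !lk_skew0 subrr h1y0 !lk_skewZ h2y1 lk_skewZ h1y2.
  rewrite !scalerA -scalerBl => e; rewrite -[RHS]oppr0 -[in RHS]e -scaleNr.
  by congr (_ *: _); ring.
(* If [a] or [b] were zero, [ea], [eb] and [sum] would contradict [d0] or [a0]. Hence both brackets
   vanish, and they add up to [2 - d ^+ 2]. *)
have [a0|a0] := eqVneq a 0.
  move: eb sum; rewrite a0 mul0r !mulr0 addr0 add0r mulr1 => ->.
  by move/eqP; rewrite mulr0 eq_sym oppr_eq0 (negPf d0).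
have [b0|b0] := eqVneq b 0.
  by move/eqP: ea; rewrite b0 mul0r mulr0 addr0 mulr1 (negPf a0).
move/eqP: ea; rewrite mulf_eq0 (negPf a0) => /eqP ea.
move/eqP: eb; rewrite mulf_eq0 (negPf b0) => /eqP eb.
have : (1 + d * (a * al)) + (1 + d * (b * be)) = 2 + d * (al * a + be * b) by ring.
rewrite sum ea eb addr0 mulrN -expr2 => /eqP.
by rewrite eq_sym subr_eq0 eq_sym => /eqP.
Qed.

End LKSmall.

(** Among the subspaces contained in [P], one of greatest dimension absorbs every vector satisfying
    [P]. *)
Lemma submodule_vspace (K : fieldType) (V : vectType K) (P : V -> Prop) :
    P 0 -> (forall u v, P u -> P v -> P (u + v)) -> (forall a v, P v -> P (a *: v)) ->
  exists W : {vspace V}, forall v, v \in W <-> P v.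
Proof.
move=> P0 PD PZ.
pose Q k := `[< exists2 W : {vspace V}, (forall v, v \in W -> P v) & \dim W = k >].
have Q0 : exists k, Q k.
  exists 0; apply/asboolP; exists 0%VS; last exact: dimv0.
  by move=> v; rewrite memv0 => /eqP->.
have Qb k : Q k -> (k <= \dim (fullv : {vspace V}))%N.
  by move=> /asboolP[W _ <-]; apply/dimvS/subvf.
case: (ex_maxnP Q0 Qb) => k /asboolP[W WP dW] kmax; exists W => v.
split=> [|Pv]; first exact: WP.
have WvP u : u \in (W + <[v]>)%VS -> P u.
  by move=> /memv_addP[x /WP Px [_ /vlineP[a ->] ->]]; apply: PD => //; apply: PZ.
have : (\dim (W + <[v]>) <= \dim W)%N.
  by rewrite dW; apply: kmax; apply/asboolP; exists (W + <[v]>)%VS.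
move=> dle; have /eqP-> : (W == W + <[v]>)%VS by rewrite eqEdim addvSl.
by apply: (subvP (addvSr _ _)); apply: memv_line.
Qed.

(** * The irreducible submodule for [l = r] *)

Section LKSubmodule.
Variables (K : fieldType) (r : K) (n : nat).
Hypotheses (r0 : r != 0) (n4 : (4 <= n)%N).
Local Notation V := (lk_space K n).
Local Notation w := (lk_w K n).
Local Notation G := (@lk_nu_fun K r r n).
Local Notation h := (@lk_skew K r r n).

(* For l = r, the transposes of the generators permute these functionals up to scalars
   (lk_S_nu), so that their common kernel is invariant. *)
Definition lk_S (j : nat) (v : V) : K := \sum_(p : lk_index n)
  (((val p).1 == j :> nat)%:R * r ^+ (val p).2
   + ((val p).2 == j :> nat)%:R * r ^+ (val p).1.+2) * v p.

Lemma lk_S_is_linear j : scalar (lk_S j).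
Proof.
move=> a u v; rewrite /lk_S mulr_sumr -big_split /=.
by apply: eq_bigr => p _; rewrite (lkD (a *: u) v p) (lkZ a u p); ring.
Qed.

HB.instance Definition _ j := GRing.isLinear.Build K V K _ (lk_S j) (lk_S_is_linear j).

Lemma lk_SD j (u v : V) : lk_S j (u + v) = lk_S j u + lk_S j v. Proof. exact: linearD. Qed.
Lemma lk_SN j (v : V) : lk_S j (- v) = - lk_S j v. Proof. exact: linearN. Qed.
Lemma lk_SZ j a (v : V) : lk_S j (a *: v) = a * lk_S j v. Proof. exact: linearZ. Qed.
Lemma lk_S0 j : lk_S j (0 : V) = 0. Proof. exact: linear0. Qed.

Lemma lk_S_w j s t : (s < t)%N -> (t < n)%N ->
  lk_S j (w s t) = (s == j)%:R * r ^+ t + (t == j)%:R * r ^+ s.+2.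
Proof.
move=> st tn; have sn := ltn_trans st tn.
pose q : lk_index n := Sub (Ordinal sn, Ordinal tn) st.
rewrite /lk_S (bigD1 q) //= lk_wE !eqxx mulr1 big1 ?addr0 // => p pq; rewrite lk_wE.
case: andP => [[/eqP e1 /eqP e2]|_]; last exact: mulr0.
by case/eqP: pq; apply: lk_index_inj; rewrite ?e1 ?e2.
Qed.

Let rq d : r ^+ d != 0. Proof. by rewrite expf_neq0. Qed.

Lemma lk_S_nu i j (v : V) : (i.+1 < n)%N ->
  lk_S j (G i v) = if j == i then r^-1 ^+ 2 * lk_S i.+1 v
                   else if j == i.+1 then lk_S i v else r * lk_S j v.
Proof.
move=> ni; elim/lk_w_ind: v => [|u v eu ev|a v ev|s t st tn].
- by rewrite lk_nu0 !lk_S0 !mulr0; repeat case: ifP.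
- by rewrite lk_nuD !lk_SD eu ev; repeat case: ifP => _; ring.
- by rewrite lk_nuZ !lk_SZ ev; repeat case: ifP => _; ring.
have [[si ti]|[[ti si]|[[ti si]|[[si ti]|[[si ti]|so]]]]] :
    (s = i /\ t = i.+1) \/ ((t = i /\ s < i)%N \/ ((t = i.+1 /\ s < i)%N \/
    ((s = i /\ i.+1 < t)%N \/ ((s = i.+1 /\ i.+1 < t)%N \/
     [&& s != i, s != i.+1, t != i & t != i.+1])))) by lia.
- rewrite si ti; lk_nu_rewrite K r r n.
  rewrite ?(lk_SD, lk_SN, lk_SZ) !lk_S_w; try lia.
  repeat (case: eqP => //= ?); try lia; rewrite !exprS;
  move: (r ^+ i) (rq i) => q q0; by field.
- have [d dE] : exists d, i = (s.+1 + d)%N by exists (i - s.+1)%N; lia.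
  rewrite ti; lk_nu_rewrite K r r n.
  rewrite ?(lk_SD, lk_SN, lk_SZ) !lk_S_w; try lia.
  repeat (case: eqP => //= ?); try lia; rewrite !exprS;
  move: (r ^+ i) (rq i) (r ^+ s) (rq s) => q q0 q' q0'; by field.
- have [d dE] : exists d, i = (s.+1 + d)%N by exists (i - s.+1)%N; lia.
  rewrite ti; lk_nu_rewrite K r r n.
  rewrite ?(lk_SD, lk_SN, lk_SZ) !lk_S_w; try lia.
  have -> : (i - s.+1)%N = d by lia.
  have qi : r ^+ i = r * r ^+ s * r ^+ d by rewrite dE exprD exprS.
  repeat (case: eqP => //= ?); try lia; rewrite !exprS ?qi;
  move: (r ^+ s) (rq s) (r ^+ d) (rq d) => q q0 q' q0'; by field; rewrite ?r0 ?q0 ?q0'.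
- have [d dE] : exists d, t = (i.+2 + d)%N by exists (t - i.+2)%N; lia.
  rewrite si; lk_nu_rewrite K r r n.
  rewrite ?(lk_SD, lk_SN, lk_SZ) !lk_S_w; try lia.
  repeat (case: eqP => //= ?); try lia; rewrite !exprS;
  move: (r ^+ i) (rq i) (r ^+ t) (rq t) => q q0 q' q0'; by field.
- have [d dE] : exists d, t = (i.+2 + d)%N by exists (t - i.+2)%N; lia.
  rewrite si; lk_nu_rewrite K r r n.
  rewrite ?(lk_SD, lk_SN, lk_SZ) !lk_S_w; try lia.
  have -> : (t - i.+2)%N = d by lia.
  have qi : r ^+ t = r * r * r ^+ i * r ^+ d by rewrite dE exprD !exprS mulrA.
  repeat (case: eqP => //= ?); try lia; rewrite !exprS ?qi;
  move: (r ^+ i) (rq i) (r ^+ d) (rq d) => q q0 q' q0'; by field.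
- lk_nu_rewrite K r r n; rewrite ?(lk_SD, lk_SN, lk_SZ) !lk_S_w; try lia.
  repeat (case: eqP => //= ?); try lia; ring.
Qed.

Definition lk_S_map (v : V) : {ffun 'I_n -> K^o} := [ffun j : 'I_n => lk_S j v].

Lemma lk_S_map_is_linear : linear lk_S_map.
Proof.
by move=> a u v; apply/ffunP => j; rewrite !ffunE lk_SD lk_SZ.
Qed.

HB.instance Definition _ :=
  GRing.isLinear.Build K V {ffun 'I_n -> K^o} _ lk_S_map lk_S_map_is_linear.

Definition lk_D : {vspace V} := lker (linfun lk_S_map).

Lemma lk_DP v : reflect (forall j, (j < n)%N -> lk_S j v = 0) (v \in lk_D).
Proof.
rewrite memv_ker lfunE; apply: (iffP eqP) => [/ffunP e j jn|e].
  by have := e (Ordinal jn); rewrite !ffunE.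
by apply/ffunP => j; rewrite !ffunE e.
Qed.

Lemma lk_D_invariant : lk_invariant r r lk_D.
Proof.
apply/(lk_invariantP r0 r0) => i v ni /lk_DP vD; apply/lk_DP => j jn.
have ni' := ltnW ni.
by rewrite lk_S_nu // !vD // !mulr0; repeat case: ifP.
Qed.

Lemma lk_Y_D : lk_Y r n \in lk_D.
Proof.
apply/lk_DP => j jn; rewrite /lk_Y !(lk_SD, lk_SN, lk_SZ) !lk_S_w; try lia.
by repeat (case: eqP => //= ?); try lia; ring.
Qed.

Hypothesis r2 : 1 + r ^+ 2 != 0.

(** [lk_S_map] is onto: it sends [w 0 1 + r *: w 0 2 - w 1 2] to [r * (1 + r ^+ 2)] times the first
    unit vector, and [w 0 j] then yields the unit vector at [j]. *)
Lemma dim_lk_D : (\dim lk_D + n = 'C(n, 2))%N.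
Proof.
rewrite -(dim_lk_space K) -(limg_ker_dim (linfun lk_S_map) fullv) capfv; congr (_ + _)%N.
suff -> : limg (linfun lk_S_map) = fullv.
  by rewrite dimvf -[RHS]/(#|'I_n| * 1)%N card_ord muln1.
apply/eqP; rewrite eqEsubv subvf; apply/subvP => f _.
pose del (j : 'I_n) : {ffun 'I_n -> K^o} := [ffun k => (k == j)%:R].
have -> : f = \sum_(j < n) (f j : K) *: del j.
  apply/ffunP => k; rewrite sum_ffunE (bigD1 k) //= !ffunE eqxx big1 ?addr0.
    by rewrite [RHS]mulr1.
  by move=> j jk; rewrite !ffunE eq_sym (negPf jk) scaler0.
have n0 : (0 < n)%N by lia.
have SI v : lk_S_map v \in limg (linfun lk_S_map).
  by rewrite -(lfunE lk_S_map) memv_img ?memvf.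
have d0 : del (Ordinal n0) \in limg (linfun lk_S_map).
  have c0 : r * (1 + r ^+ 2) != 0 by rewrite mulf_neq0.
  have := memvZ (r * (1 + r ^+ 2))^-1 (SI (w 0 1 + r *: w 0 2 - w 1 2)).
  congr (_ \in limg (linfun lk_S_map)); apply/ffunP => k; rewrite !ffunE.
  have kE : (k == Ordinal n0) = (0 == k :> nat) by rewrite -val_eqE eq_sym.
  have aux (k' : nat) : lk_S k' (w 0 1 + r *: w 0 2 - w 1 2) =
      r * (1 + r ^+ 2) * (0 == k')%:R.
    rewrite !(lk_SD, lk_SN, lk_SZ) !lk_S_w; try lia.
    by repeat (case: eqP => //= ?); try lia; ring.
  by rewrite kE aux; exact: (mulKf c0).
apply: memv_suml => j _; apply: memvZ.
have [->//|j0] := eqVneq j (Ordinal n0).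
have j0' : (0 < j)%N by move: j0; rewrite -val_eqE /=; lia.
have := memvZ (r^-1 ^+ 2) (memvB (SI (w 0 j)) (memvZ (r ^+ j) d0)).
congr (_ \in limg (linfun lk_S_map)); apply/ffunP => k; rewrite !ffunE.
have kE : (k == Ordinal n0) = (0 == k :> nat) by rewrite -val_eqE eq_sym.
have jE : (k == j) = (j == k :> nat) by rewrite -val_eqE eq_sym.
have aux : r^-1 ^+ 2 * (lk_S k (w 0 j) - r ^+ j * (0 == k :> nat)%:R) =
    (j == k :> nat)%:R.
  by rewrite lk_S_w //; move: (r ^+ j) => q; field.
by rewrite kE jE; exact: aux.
Qed.

(** The codimension of [U] is at most [n] by [lk_Y_dim], and that of [lk_D] is exactly [n]. *)
Lemma lk_D_generated (U : {vspace V}) :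
  lk_invariant r r U -> (U <= lk_D)%VS -> lk_Y r n \in U -> U = lk_D.
Proof.
move=> UI UD YU; apply/eqP; rewrite eqEdim UD /=.
by have := lk_Y_dim r0 r0 n4 UI YU; rewrite -dim_lk_D leq_add2r.
Qed.

Lemma lk_D_proper : lk_D <> fullv.
Proof. by move=> e; have := dim_lk_D; rewrite e dim_lk_space; lia. Qed.

Lemma lk_D_irreducible : semisimple_ring (hecke r n) -> lk_irreducible r r lk_D.
Proof.
move=> ss; split=> [D0|U UI UD].
  by have := lk_Y_D; rewrite D0 memv0 (negPf (lk_Y_neq0 r n4)).
have [YU|YU] := boolP (lk_Y r n \in U); first by right; apply: lk_D_generated.
left; pose g (i : 'I_n.-1) : {linear V -> V} := G i.
have stable (W : {vspace V}) : lk_invariant r r W -> gstable g (fun v => v \in W).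
  move=> /(lk_invariantP r0 r0) WI.
  split; [exact: mem0v | exact: memvD | by move=> k; apply: memvZ |].
  by move=> i v vW; apply: WI => //; have := ltn_ord i; lia.
have gD := stable _ lk_D_invariant; have gU := stable _ UI.
have relP := @aeval_hecke_rel K r n V (fun i => G i) (fun v => v \in lk_D) gD
  (fun i v ni vD => lk_nu_quadratic r0 r0 lk_D_invariant lk_D_proper ni vD)
  (fun i v ni _ => lk_nu_braid r0 r0 v ni)
  (fun i j v ij jn _ => lk_nu_commute r0 r0 v ij jn).
have [x [xD Ux xP]] := split_cyclic gD relP ss gU lk_Y_D.
(* [T] is the submodule generated by [x]; its elements are the values [aeval g a x]. *)
have [T TP] := @submodule_vspace K V (fun v => exists a, v = aeval g a x)
  (ex_intro _ (ACst 0) (esym (scale0r x)))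
  (fun u v '(ex_intro a ea) '(ex_intro b eb) =>
     ex_intro _ (AAdd a b) (etrans (congr1 (+%R^~ v) ea) (congr1 (+%R _) eb)))
  (fun k v '(ex_intro a ea) => ex_intro _ (AMul (ACst k) a) (congr1 ( *:%R k) ea)).
have TI : lk_invariant r r T.
  apply/(lk_invariantP r0 r0) => i v ni /TP[a ->]; apply/TP.
  have ni' : (i < n.-1)%N by lia.
  by exists (AMul (AGen (Ordinal ni')) a).
have TD : (T <= lk_D)%VS.
  by apply/subvP => v /TP[a ->]; apply: (gstable_aeval gD).
have YT : lk_Y r n \in T.
  have i0 : (0 < n.-1)%N by lia.
  have i2 : (2 < n.-1)%N by lia.
  pose e := AMul (AAdd (AGen (Ordinal i2)) (ACst (- r)))
                 (AAdd (AGen (Ordinal i0)) (ACst (- r))).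
  have eE v : aeval g e v = h 2 (h 0 v) by rewrite /lk_skew /= !scaleNr.
  have [c cE] := lk_skew_skew r0 r0 n4 x.
  (* On [Y - x], a vector of [U], the operator [e] gives [(r + r^-1) ^+ 2 - c] times [Y]. As [Y] is
     not in [U], this scalar is zero, and so [c] is nonzero. *)
  have := gstable_aeval gU e Ux.
  rewrite eE (lk_skewB r r 0) (lk_skewB r r 2) (lk_skew_Y r0 r0 n4) cE -scalerBl => cU.
  have {}cU : (r + r^-1) ^+ 2 - c = 0.
    apply/eqP/negPn/negP => c0; case/negP: YU.
    move: cU => /(memvZ ((r + r^-1) ^+ 2 - c)^-1).
    by rewrite scalerA mulVf // scale1r.
  have c0 : c != 0.
    have <- : (r + r^-1) ^+ 2 = c by apply/eqP; rewrite -subr_eq0 cU.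
    have -> : r + r^-1 = (1 + r ^+ 2) / r by field.
    by rewrite expf_neq0 // mulf_neq0 ?invr_eq0.
  have : c *: lk_Y r n \in T by apply/TP; exists e; rewrite eE.
  by move=> /(memvZ c^-1); rewrite scalerA mulVf // scale1r.
(* Now [U] lies in [lk_D = T], and [xP] says that [T] meets [U] trivially. *)
apply/eqP; rewrite -subv0; apply/subvP => u uU; rewrite memv0; apply/eqP.
have : u \in T by rewrite (lk_D_generated TI TD YT) (subvP UD).
by move=> /TP[a ea]; rewrite ea; apply: xP; rewrite -ea.
Qed.

End LKSubmodule.

(** The truncated division is harmless, as [n (n - 1)] and [n (n - 3)] differ by [2 n]. *)
Lemma bin2_split n : (4 <= n)%N -> 'C(n, 2) = (n * (n - 3) %/ 2 + n)%N.
Proof.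
move=> n4; have [k ->] : exists k, n = (k + 4)%N by exists (n - 4)%N; lia.
rewrite bin2 -divn2 (_ : (k + 4 - 3 = k.+1)%N); last lia.
rewrite (_ : (k + 4) * (k + 4).-1 = (k + 4) * 2 + (k + 4) * k.+1)%N; last nia.
by rewrite divnMDl // addnC.
Qed.

Lemma add_inv_neq0 (K : fieldType) (r : K) :
  r != 0 -> 1 + r ^+ 2 != 0 -> r + r^-1 != 0.
Proof.
by move=> r0 r2; rewrite (_ : _ + _ = (1 + r ^+ 2) / r) ?mulf_neq0 ?invr_eq0 //; field.
Qed.

(** * Determination of [l], and uniqueness *)

Section LKMain.
Variables (K : fieldType) (l r : K) (n : nat).
Hypotheses (l0 : l != 0) (r0 : r != 0) (n4 : (4 <= n)%N).
Hypothesis ss : semisimple_ring (hecke r n).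
Let r2 : 1 + r ^+ 2 != 0.
Proof. exact: (semisimple_hecke_two r0 ss (ltnW (ltnW n4))). Qed.
Local Notation V := (lk_space K n).
Local Notation Y := (lk_Y r n).

Section Submodule.
Variable W : {vspace V}.
Hypotheses (WI : lk_invariant l r W) (Wirr : lk_irreducible l r W).
Hypothesis dW : \dim W = (n * (n - 3) %/ 2)%N.

Lemma lk_W_dim_ge2 : (2 <= \dim W)%N.
Proof.
by rewrite dW leq_divRL //; case: n n4 => [|[|[|[|k]]]] // _; nia.
Qed.

Lemma lk_W_proper : W <> fullv.
Proof. by move=> e; move: dW; rewrite e dim_lk_space bin2_split //; lia. Qed.

(** Such a [v], if nonzero, would span an invariant line inside the irreducible [W], whose dimension
    is at least 2. *)
Lemma no_common_eigenvector v : v \in W ->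
  (forall i, (i.+1 < n)%N -> lk_skew l r i v = 0) -> v = 0.
Proof.
move=> vW hv; apply/eqP/negPn/negP => v0.
have vI : lk_invariant l r <[v]>%VS.
  apply/(lk_invariantP l0 r0) => i u ni /vlineP[a ->]; apply/vlineP; exists (a * r).
  by rewrite lk_nuZ -scalerA; congr (_ *: _); apply/eqP; rewrite -subr_eq0; apply/eqP/hv.
have vW' : (<[v]> <= W)%VS by rewrite -memvE.
have [v00|vE] := Wirr.2 _ vI vW'.
  by move: (memv_line v); rewrite v00 memv0 (negPf v0).
by have := lk_W_dim_ge2; rewrite -vE dim_vline; case: (v != 0).
Qed.

Lemma lk_Y_mem : Y \in W.
Proof.
apply/negPn/negP => YW.
have dle := lk_small_dim l0 r0 n4 WI lk_W_proper YW no_common_eigenvector.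
have n_4 : n = 4.
  (* The bound [n (n - 3) / 2 <= n - 1] leaves only [n = 4]; the [+ 1] below absorbs the remainder
     of the division by 2. *)
  have := bin2_split n4; rewrite -dW bin2 -divn2 => e.
  have : (n * n.-1 <= 2 * (n.-1 + n) + 1)%N.
    by have := divn_eq (n * n.-1) 2; have := ltn_pmod (n * n.-1) (isT : 0 < 2)%N; lia.
  by move: n4; nia.
have d2 : \dim W = 2 by rewrite dW n_4.
have := lk_small_four l0 r0 n4 WI lk_W_proper YW no_common_eigenvector
  (add_inv_neq0 r0 r2) n_4 d2.
move=> d22; have n0 : (0 < n)%N by lia.
case/eqP: (semisimple_hecke_quantum_int r0 ss n0).
rewrite n_4 !big_ord_recl big_ord0 /bump /=.
(* For [n = 4] the sum is [(1 + r ^+ 2) (1 + r ^+ 4)], and [1 + r ^+ 4] is [r ^+ 2] times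
   [(r + r^-1) ^+ 2 - 2]. *)
have -> : r ^+ (2 * 0) + (r ^+ (2 * (1 + 0)) + (r ^+ (2 * (1 + (1 + 0))) +
    (r ^+ (2 * (1 + (1 + (1 + 0)))) + 0))) = (1 + r ^+ 2) * r ^+ 2 * ((r + r^-1) ^+ 2 - 2).
  by field.
by rewrite d22 subrr mulr0.
Qed.

Lemma lk_param_eq : l = r.
Proof.
have [//|lr] := lk_Y_invariant_param l0 r0 n4 WI lk_W_proper lk_Y_mem.
have := lk_Y_dim_minus l0 r0 n4 lr r2 WI lk_Y_mem.
by rewrite bin2_split // dW; lia.
Qed.

End Submodule.

Lemma lk_invariant_cap (W1 W2 : {vspace V}) :
  lk_invariant l r W1 -> lk_invariant l r W2 -> lk_invariant l r (W1 :&: W2).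
Proof.
move=> /(lk_invariantP l0 r0) I1 /(lk_invariantP l0 r0) I2.
apply/(lk_invariantP l0 r0) => i v ni; rewrite !memv_cap => /andP[v1 v2].
by rewrite I1 ?I2.
Qed.

Lemma lk_irreducible_unique (W1 W2 : {vspace V}) :
  [/\ lk_invariant l r W1, lk_irreducible l r W1 & \dim W1 = (n * (n - 3) %/ 2)%N] ->
  [/\ lk_invariant l r W2, lk_irreducible l r W2 & \dim W2 = (n * (n - 3) %/ 2)%N] ->
  W1 = W2.
Proof.
move=> [I1 irr1 d1] [I2 irr2 d2].
have Y1 := lk_Y_mem I1 irr1 d1; have Y2 := lk_Y_mem I2 irr2 d2.
have I12 := lk_invariant_cap I1 I2.
have cap0 : (W1 :&: W2)%VS <> 0%VS.
  by move=> e; have := memv_cap Y W1 W2; rewrite e Y1 Y2 memv0 (negPf (lk_Y_neq0 r n4)).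
have [//|<-] := irr1.2 _ I12 (capvSl _ _).
by have [//|->] := irr2.2 _ I12 (capvSr _ _).
Qed.

End LKMain.

Lemma lk_irreducible_exists (K : fieldType) (r : K) (n : nat) :
    r != 0 -> (4 <= n)%N -> semisimple_ring (hecke r n) ->
  [/\ lk_invariant r r (lk_D r n), lk_irreducible r r (lk_D r n) &
      \dim (lk_D r n) = (n * (n - 3) %/ 2)%N].
Proof.
move=> r0 n4 ss; have r2 := semisimple_hecke_two r0 ss (ltnW (ltnW n4)).
split; [exact: lk_D_invariant | exact: lk_D_irreducible |].
by apply/eqP; rewrite -(eqn_add2r n) dim_lk_D // bin2_split.
Qed.

Theorem theorem5 (R : realType) (l r : R[i]) (n : nat)
    (hl : l != 0) (hr : r != 0) (hr2 : r ^+ 2 != 1) (hn : (4 <= n)%N)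
    (hss : semisimple_ring (hecke (adjoin_r l r) n)) :
  let V := lk_space (adjoin2 l r) n in
  let P (W : {vspace V}) :=
    [/\ lk_invariant (adjoin_l l r) (adjoin_r l r) W,
        lk_irreducible (adjoin_l l r) (adjoin_r l r) W &
        \dim W = (n * (n - 3) %/ 2)%N] in
  ((exists W : {vspace V}, P W) <-> l = r) /\
  (forall W1 W2 : {vspace V}, P W1 -> P W2 -> W1 = W2).
Proof.
move=> V P.
(* The results above are over an arbitrary field and are applied to Q(l, r); conditions on [l] and
   [r] are transported along its embedding in [R[i]]. *)
have val_neq0 (x : adjoin2 l r) : adjoin2_val x != 0 -> x != 0.
  by apply: contra_neq => ->.
have l0 : adjoin_l l r != 0 by apply: val_neq0.
have r0 : adjoin_r l r != 0 by apply: val_neq0.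
have lrE : adjoin_l l r = adjoin_r l r <-> l = r.
  split=> [/(congr1 (@adjoin2_val _ l r)) //|lr].
  exact/val_inj.
split; last first.
  by move=> W1 W2; apply: lk_irreducible_unique.
split=> [[W [WI Wirr dW]]|lr].
  by apply/lrE; apply: (lk_param_eq l0 r0 hn hss WI Wirr dW).
exists (lk_D (adjoin_r l r) n).
by rewrite /P (lrE.2 lr); apply: lk_irreducible_exists.
Qed.
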